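(* For each $d\ge1$ let $\chi(\overline{P}_d)$ denote the Euler characteristic of the polyhedral complex $\overline{P}_d$. Then $$\tanh x=\sum_{d=1}^{\infty}\chi\left(\overline{P}_d\right)\frac{x^d}{d!}$$ (as a power series expansion at $x=0$).
   Context: For each $d\ge1$, $\overline{P}_d$ is constructed from a set $\Lambda=\{\lambda_1,\dots,\lambda_d\}\subset\mathbf{R}$ of $d$ distinct reals as follows. Write $[d]=\{1,\dots,d\}$. Coordinates. For non-empty $S\subseteq[d]$, $W^S=\{w:S\to\mathbf{R}\mid w\ne 0\}/\!\sim$ is the real projective space of non-zero maps modulo non-zero real scaling, and $W_+^S=\{w\in W^S\mid w_mw_n>0\ \forall m,n\in S\}$. $\mathcal{P}_{[d]}$ is the set of ordered partitions of $[d]$: sequences $(S_1,\dots,S_r)$ of non-empty pairwise disjoint sets with union $[d]$. $W_+^{(S_1,\dots,S_r)}=W_+^{S_1}\times\cdots\times W_+^{S_r}$, elements written $w^{S_1}\oplus\cdots\oplus w^{S_r}$; $\overline{\mathcal{D}}^\Lambda$ is the disjoint union of these over $\mathcal{P}_{[d]}$. $(R_1,\dots,R_q)\preceq(S_1,\dots,S_r)$ means that $(R_1,\dots,R_q)$ is a concatenation of ordered partitions of $S_1$, of $S_2$, ..., of $S_r$, in this order. The map $\overline f$. For non-empty $S\subseteq[d]$, $m=|S|$, $w\in W_+^S$, put $\langle p,q\rangle=\sum_{n\in S}w_np(\lambda_n)q(\lambda_n)$. Set $p_0=1$, $a_1=\langle1,\lambda\rangle/\langle1,1\rangle$, $p_1(\lambda)=\lambda-a_1$,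 and for $1\le n\le m-1$, $a_{2n}=\sqrt{\langle p_n,p_n\rangle/\langle p_{n-1},p_{n-1}\rangle}$, $a_{2n+1}=\langle p_n,\lambda p_n\rangle/\langle p_n,p_n\rangle$, $p_{n+1}(\lambda)=(\lambda-a_{2n+1})p_n(\lambda)-a_{2n}^2p_{n-1}(\lambda)$. $f(w)$ is the $m\times m$ symmetric tridiagonal matrix with diagonal $a_1,a_3,\dots,a_{2m-1}$ and next-to-diagonal entries $a_2,a_4,\dots,a_{2m-2}$. $\overline f(w^{S_1}\oplus\cdots\oplus w^{S_r})=f(w^{S_1})\oplus\cdots\oplus f(w^{S_r})$ (block diagonal). $\mathcal{B}^\Lambda$ and $\pi$. Let $C_i^S=\prod_{n\in S}(\lambda_n-\lambda_i)^2$, $C_i^\emptyset=1$, and $\mathcal{W}=\prod_{\emptyset\ne S\subseteq[d]}W^S$. $\mathcal{B}^\Lambda$ is the set of $w\in\mathcal{W}$ with $C_i^{S-R}w_j^Rw_i^S=C_j^{S-R}w_i^Rw_j^S$ for all non-empty $R\subseteq S\subseteq[d]$, $i,j\in R$, and $w_i^Sw_j^S\ge0$ for all non-empty $S\subseteq[d]$, $i,j\in S$. For $w\in\mathcal{B}^\Lambda$, $n\in[d]$, let $\varphi_w(n)$ be the unique $S\ni n$ of maximal cardinality with $w_n^S\ne0$; the range of $\varphi_w$ is a chain $[d]=K_1\supset\cdots\supset K_r\ne\emptyset$; with $(S_1,\dots,S_r)=(K_1-K_2,\dots,K_{r-1}-K_r,K_r)$ put $\pi(w)=(w_n^{K_1})_{n\in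 S_1}\oplus\cdots\oplus(w_n^{K_r})_{n\in S_r}\in W_+^{(S_1,\dots,S_r)}$. The map $\pi:\mathcal{B}^\Lambda\to\overline{\mathcal{D}}^\Lambda$ is a bijection. The faces of $\mathcal{B}^\Lambda$ are $\mathcal{B}^\Lambda_{(S_1,\dots,S_r)}=\mathrm{cl}(\pi^{-1}(W_+^{(S_1,\dots,S_r)}))$. Permutahedron. $\mathrm{Sym}[d]$ is the group of permutations of $[d]$, each $\sigma$ identified with the point $(\sigma(1),\dots,\sigma(d))\in\mathbf{R}^d$; $P_d$ is the convex hull of these points; $\widehat F$ denotes the convex hull of $F$. For $R\subseteq[d]$, $\mathrm{Sym}(R)\le\mathrm{Sym}[d]$ is the subgroup fixing every element of $[d]-R$. $\mathcal{G}$ is the collection of subgroups $\mathrm{Sym}(R_1)\times\cdots\times\mathrm{Sym}(R_q)$ with $(\{1\},\dots,\{d\})\preceq(R_1,\dots,R_q)\in\mathcal{P}_{[d]}$ (so the $R_j$ are consecutive intervals). The faces of $P_d$ are exactly the sets $\widehat F$ with $F=G\sigma$ a right coset, $G\in\mathcal{G}$, $\sigma\in\mathrm{Sym}[d]$. For such $F=G\sigma$ with $G=\mathrm{Sym}(R_1)\times\cdots\times\mathrm{Sym}(R_q)$, where $(\{1\},\dots,\{d\})\preceq(R_1,\dots,R_q)\in\mathcal{P}_{[d]}$, $\varphi(F)=(\sigma^{-1}(R_1),\dots,\sigma^{-1}(R_q))\in\mathcal{P}_{[d]}$. Fixed throughout is a homeomorphism $h:P_d\to\mathcal{B}^\Lambda$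 with $h(\widehat F)=\mathcal{B}^\Lambda_{\varphi(F)}$ for every face $\widehat F$ of $P_d$ (such $h$ exists). The complex. For $p\in P_d$ let $J_p=\overline f\circ\pi\circ h(p)$. $\mathcal{E}$ is the (discrete) set of maps $\varepsilon:[d]\to\{+1,-1\}$. For $(p,\varepsilon)\in P_d\times\mathcal{E}$, $g(p,\varepsilon)=\mathrm{diag}(\varepsilon)J_p\,\mathrm{diag}(\varepsilon)$; $(p,\varepsilon)\sim(p',\varepsilon')$ iff $g(p,\varepsilon)=g(p',\varepsilon')$; $\overline{P}_d=(P_d\times\mathcal{E})/\!\sim$ is the quotient space, and its faces are the images of the sets $\widehat F\times\{\varepsilon\}$. It is homeomorphic to the space of $d\times d$ real symmetric tridiagonal matrices with spectrum $\Lambda$. Its Euler characteristic is $\sum_n(-1)^n\cdot$(number of $n$-dimensional faces). *)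

(* Defs.v *)
From HB Require Import structures.
From mathcomp Require Import all_boot all_order all_algebra all_fingroup.
From mathcomp Require Import generic_quotient.

Set Implicit Arguments.
Unset Strict Implicit.
Unset Printing Implicit Defensive.

Section OrderedPartitions.
Variable T : finType.

Definition ordered_partition (A : {set T}) (s : seq {set T}) : bool :=
  [&& set0 \notin s,
      pairwise (fun B C : {set T} => [disjoint B & C]) s
    & \bigcup_(B <- s) B == A].

(* refines r s is r \preceq s. *)
Definition refines (r s : seq {set T}) : Prop :=
  exists2 rs : seq (seq {set T}), r = flatten rs & all2 ordered_partition s rs.

End OrderedPartitions.

From mathcomp Require Import finmap.
From mathcomp Require Import all_classical all_reals all_analysis.

Import Order.TTheory GRing.Theory Num.Theory.
Import numFieldNormedType.Exports.

Local Open Scope classical_set_scope.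
Local Open Scope ring_scope.
Local Open Scope quotient_scope.

(* Throughout, the index set [d] = {1, ..., d} is 'I_d = {0, ..., d - 1}, and
   Lambda is given by an injective labelling lam : 'I_d -> R.               *)

Definition tanh (R : realType) (x : R) : R :=
  (expR x - expR (- x)) / (expR x + expR (- x)).

Definition homeomorphism (X Y : topologicalType) (h : X -> Y) : Prop :=
  continuous h /\
  exists g : Y -> X, [/\ cancel h g, cancel g h & continuous g].

(* The affine hull of A is x + U. *)
Definition has_affine_dim (R : realType) (d : nat) (A : set 'rV[R]_d) (n : nat)
    : Prop :=
  exists (x : 'rV[R]_d) (U : {vspace 'rV[R]_d}),
    [/\ A x, forall y, A y -> y - x \in U,
        forall V : {vspace 'rV[R]_d},
          (forall y, A y -> y - x \in V) -> (U <= V)%VS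
      & \dim U = n].

Section Projective.
Variables (R : realType) (d : nat).
Implicit Types S : {set 'I_d}.

Definition nzmap S : Type :=
  set_type [set v : {ptws {i : 'I_d | i \in S} -> R} | exists i, v i != 0].
HB.instance Definition _ S := Topological.on (nzmap S).

Definition proportional S (v w : nzmap S) : bool :=
  `[< exists2 c : R, c != 0 & forall i, set_val w i = c * set_val v i >].

Lemma proportional_refl S : reflexive (@proportional S).
Proof. by move=> v; apply/asboolP; exists 1 => // i; rewrite mul1r. Qed.

Lemma proportional_sym S : symmetric (@proportional S).
Proof.
suff H (v w : nzmap S) : proportional v w -> proportional w v.
  by move=> v w; apply/idP/idP; exact: H.
move=> /asboolP[c c0 e]; apply/asboolP; exists c^-1; first by rewrite invr_eq0.
by move=> i; rewrite e mulKf.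
Qed.

Lemma proportional_trans S : transitive (@proportional S).
Proof.
move=> v u w /asboolP[c c0 e] /asboolP[b b0 e']; apply/asboolP.
by exists (b * c); [rewrite mulf_neq0 | move=> i; rewrite e' e mulrA].
Qed.

Canonical proportional_equiv S :=
  EquivRel (@proportional S) (@proportional_refl S) (@proportional_sym S)
    (@proportional_trans S).

(* The projective space W^S, with its quotient topology. *)
Definition pspace S : Type :=
  quotient_topology {eq_quot (proportional_equiv S)}.
HB.instance Definition _ S := Topological.on (pspace S).
HB.instance Definition _ S := Quotient.on (pspace S).

(* The homogeneous coordinate w_i of w in W^S, for a chosen representative;
   it is meaningful up to a common scalar, and 0 when i \notin S. *)
Definition hcoord S (w : pspace S) (i : 'I_d) : R :=
  if insub i is Some j then set_val (repr w) j else 0.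

(* The class in W^S of the restriction of v to S, if that is non-zero. *)
Definition pclass S (v : 'I_d -> R) : option (pspace S) :=
  omap (fun u : nzmap S => \pi_(pspace S) u)
    (insub (fun i : {i : 'I_d | i \in S} => v (val i))).

Definition positive S (w : pspace S) : Prop :=
  forall m n : 'I_d, m \in S -> n \in S -> 0 < hcoord w m * hcoord w n.

(* w^{S_1} (+) ... (+) w^{S_r} is encoded as the sequence of the w^{S_k},
   each tagged with S_k. *)
Definition psum : Type := seq {S : {set 'I_d} & pspace S}.

Definition stratum (s : seq {set 'I_d}) : set psum :=
  [set x | [seq tag y | y <- x] = s /\
           forall k : 'I_(size x), positive (tagged (tnth (in_tuple x) k))].

Definition pprod : Type :=
  prod_topology (fun S : {S : {set 'I_d} | S != finset.set0} =>
    pspace (val S)).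
HB.instance Definition _ := Topological.on pprod.

(* w_i^S *)
Definition coord (w : pprod) (S : {set 'I_d}) (i : 'I_d) : R :=
  if insub S is Some S' then hcoord (w S') i else 0.

End Projective.

Section Jacobi.
Variables (R : realType) (d : nat) (lam : 'I_d -> R).
Implicit Types S : {set 'I_d}.

Section Block.
Variables (S : {set 'I_d}) (w : pspace R S).

Definition ip (p q : {poly R}) : R :=
  \sum_(n in S) hcoord w n * p.[lam n] * q.[lam n].

Definition diag_coef (p : {poly R}) : R := ip p ('X * p) / ip p p.

Definition offdiag_coef (p q : {poly R}) : R :=
  Num.sqrt (ip q q / ip p p).

Fixpoint orth (n : nat) : {poly R} :=
  match n with
  | 0 => 1
  | m.+1 =>
    match m with
    | 0 => 'X - (diag_coef 1)%:P
    | k.+1 => ('X - (diag_coef (orth m))%:P) * orth m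
              - (offdiag_coef (orth k) (orth m) ^+ 2) *: orth k
    end
  end.

(* a_(2n + 1) and, for n >= 1, a_(2n) *)
Definition a_odd (n : nat) : R := diag_coef (orth n).
Definition a_even (n : nat) : R := offdiag_coef (orth n.-1) (orth n).

Definition jacobi_mx : 'M[R]_#|S| :=
  \matrix_(i, j) if i == j then a_odd i
                 else if i.+1 == j :> nat then a_even j
                 else if j.+1 == i :> nat then a_even i
                 else 0.

End Block.

(* The blocks have total size d when x lies in a stratum of an ordered
   partition of 'I_d, so that conform_mx is then just a cast. *)
Definition jacobi_sum (x : psum R d) : 'M[R]_d :=
  conform_mx (0 : 'M[R]_d)
    (\mxdiag_(k < size x) jacobi_mx (tagged (tnth (in_tuple x) k))).

Definition Ccoef S (i : 'I_d) : R := \prod_(n in S) (lam n - lam i) ^+ 2.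

Definition Bset : set (pprod R d) :=
  [set w |
    (forall S' S : {set 'I_d}, S' != finset.set0 -> S' \subset S ->
     forall i j, i \in S' -> j \in S' ->
       Ccoef (S :\: S')%SET i * coord w S' j * coord w S i =
       Ccoef (S :\: S')%SET j * coord w S' i * coord w S j) /\
    (forall S, S != finset.set0 -> forall i j, i \in S -> j \in S ->
       0 <= coord w S i * coord w S j)].

Definition Bspace : Type := set_type Bset.
HB.instance Definition _ := Topological.on Bspace.

(* The singleton qualifies, since w^{n} is a point of projective space; on B
   the maximizer is unique. *)
Definition phi_w (w : pprod R d) (n : 'I_d) : {set 'I_d} :=
  [arg max_(S > [set n]%SET | (n \in S) && (coord w S n != 0)%R) #|S|]%N.

(* K_1, ..., K_r *)
Definition phi_chain (w : pprod R d) : seq {set 'I_d} :=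
  sort (fun A B : {set 'I_d} => #|B| <= #|A|)%N
    (undup [seq phi_w w n | n <- enum 'I_d]).

(* On B, w^{K_k} does not vanish on K_k - K_(k+1) (with K_(r+1) empty), so
   that pmap drops nothing. *)
Definition pi_map (w : Bspace) : psum R d :=
  let K := phi_chain (set_val w) in
  pmap (fun AB : {set 'I_d} * {set 'I_d} =>
          omap (Tagged (@pspace R d))
            (pclass (AB.1 :\: AB.2)%SET (coord (set_val w) AB.1)))
    (zip K (rcons (behead K) finset.set0)).

Definition Bface (s : seq {set 'I_d}) : set Bspace :=
  closure (pi_map @^-1` stratum s).

End Jacobi.

Section Permutahedron.
Variables (R : realType) (d : nat).

Definition perm_point (s : 'S_d) : 'rV[R]_d := \row_i ((s i).+1)%:R.

Definition hull (F : {set 'S_d}) : set 'rV[R]_d :=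
  [set x | exists t : 'S_d -> R,
    [/\ forall s, 0 <= t s, \sum_(s in F) t s = 1
      & x = \sum_(s in F) t s *: perm_point s]].

Definition permutahedron : Type := set_type (hull [set: 'S_d]%SET).
HB.instance Definition _ := Topological.on permutahedron.

(* The (R_1, ..., R_q) that index the groups in G. *)
Definition interval_partition (Rs : seq {set 'I_d}) : Prop :=
  ordered_partition [set: 'I_d]%SET Rs /\
  refines [seq [set i]%SET | i <- enum 'I_d] Rs.

(* The right coset G s = {g \o s | g in G} for composition of functions. It is
   a left coset here because (s * g)%g = g \o s. *)
Definition face_coset (Rs : seq {set 'I_d}) (s : 'S_d) : {set 'S_d} :=
  (s *: (\prod_(A <- Rs) Sym A))%g.

Definition face_partition (Rs : seq {set 'I_d}) (s : 'S_d) : seq {set 'I_d} :=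
  [seq (s @^-1: A)%SET | A : {set 'I_d} <- Rs].

Definition Pface (Rs : seq {set 'I_d}) (s : 'S_d) : set permutahedron :=
  [set p | hull (face_coset Rs s) (set_val p)].

End Permutahedron.

Section Complex.
Variables (R : realType) (d : nat) (lam : 'I_d -> R).
Variable h : permutahedron R d -> Bspace lam.

(* true encodes the sign -1. *)
Definition signs : Type := {ptws 'I_d -> bool}.
HB.instance Definition _ := Topological.on signs.

Definition Jmx (p : permutahedron R d) : 'M[R]_d := jacobi_sum lam (pi_map (h p)).

Definition diag_sign (e : signs) : 'M[R]_d := diag_mx (\row_i (-1) ^+ e i).

Definition signed_Jmx (x : permutahedron R d * signs) : 'M[R]_d :=
  diag_sign x.2 *m Jmx x.1 *m diag_sign x.2.

Definition same_matrix (x y : permutahedron R d * signs) : bool :=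
  signed_Jmx x == signed_Jmx y.

Lemma same_matrix_refl : reflexive same_matrix.
Proof. by move=> x; exact: eqxx. Qed.

Lemma same_matrix_sym : symmetric same_matrix.
Proof. by move=> x y; exact: eq_sym. Qed.

Lemma same_matrix_trans : transitive same_matrix.
Proof. by move=> y x z /eqP xy /eqP yz; apply/eqP; rewrite xy. Qed.

Canonical same_matrix_equiv :=
  EquivRel same_matrix same_matrix_refl same_matrix_sym same_matrix_trans.

Definition Pbar : Type := quotient_topology {eq_quot same_matrix_equiv}.
HB.instance Definition _ := Topological.on Pbar.
HB.instance Definition _ := Quotient.on Pbar.

Definition Pbar_faces (n : nat) : set (set Pbar) :=
  [set A | exists (Rs : seq {set 'I_d}) (s : 'S_d) (e : signs),
    [/\ interval_partition Rs, has_affine_dim (hull (R := R) (face_coset Rs s)) n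
      & A = \pi_Pbar @` (Pface (R := R) Rs s `*` [set e])]].

(* Faces of a polytope in R^d have dimension at most d, so this runs over all
   faces; there are finitely many of them. *)
Definition euler_char : int :=
  \sum_(n < d.+1) (-1) ^+ n * (#|` fset_set (Pbar_faces n)|)%:Z.

End Complex.

(* Main.v *)
Require Import Defs.
From mathcomp Require Import all_boot all_order all_algebra all_fingroup.
From mathcomp Require Import all_classical all_reals all_analysis.
From mathcomp Require Import finmap zify ring lra.
Import Order.TTheory GRing.Theory Num.Theory.
Import numFieldNormedType.Exports.

(** The faces of the complex are counted by dimension, and the signed counts
    are then recognized as the coefficients of the hyperbolic tangent.

    Counting.  Let t be an ordered partition of the index set into r blocks,
    P_t the corresponding face of the permutahedron, of dimension d - r
    (face_affine_dim), and call the image of P_t times a sign vector e the cell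
    of t and e.  Over a generic point of P_t the Jacobi matrix is a direct sum
    of r unreduced blocks: its superdiagonal is positive inside a block and
    vanishes exactly at the r - 1 places where a new block begins; over the
    other points of P_t it has at least these zeros.  Conjugation by diag(e)
    multiplies the superdiagonal entry at (i, i + 1) by e_i e_(i+1), so two sign
    vectors give the same cell exactly when these products agree inside each
    block (cell_signs), which leaves 2 ^ (d - r) cells over P_t.  Moreover cells
    over different faces are different (cell_partition): a vertex of P_t has a
    diagonal matrix, whose diagonal lists the eigenvalues in the order given by
    the vertex, so from a cell one reads off the vertices of its face.  Hence
    there are 2 ^ n N(d, d - n) faces of dimension n, where N(d, r) is the
    number of ordered partitions into r blocks, and the Euler characteristic is
    the sum of (-2) ^ n N(d, d - n) (euler_char_count).

    The order carried by a point of B.  All of this needs to know in which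
    stratum a point w of B lies.  The coordinates of w indexed by two-element
    sets suffice: put n <= i when the coordinate n of w on {i, n} is nonzero.
    This is a total preorder, the set phi_w n of the definition of pi is the
    up-set of n (phi_wE), and the blocks of pi w are the classes of the preorder
    in increasing order (pi_map_blocks).  Since the vanishing of a coordinate is
    a closed condition, the strict inequalities that hold on a stratum persist
    on its closure (Bface_blk).  In particular the preorder of the image of a
    vertex under h is the total order given by that vertex (vertex_phi).

    Summation.  Removing the first block of an ordered partition gives a
    recurrence for N, hence one for the coefficients c_d of x ^ d / d! in
    1 + sum of chi_d x ^ d / d!: multiplied by 1 + exp (- 2 x) this series is 2
    (conv_cell_exp).  The c_d / d! are bounded by 4 ^ d, which is enough to show
    that the product of the partial sums tends to 2 for small x
    (truncated_product).  So the series converges to 2 / (1 + exp (- 2 x)), which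
    is 1 + tanh x. *)

Set Implicit Arguments.
Unset Strict Implicit.
Unset Printing Implicit Defensive.

(** * Total preorders given by their up-sets *)

Section Chain.
Variables (d : nat) (phi : 'I_d -> {set 'I_d}).
Hypothesis phiE : forall i n, (i \in phi n) = (phi i \subset phi n).
Hypothesis phi_total : forall i n, (i \in phi n) || (n \in phi i).

Definition chain : seq {set 'I_d} :=
  sort (fun A B : {set 'I_d} => #|B| <= #|A|)
    (undup [seq phi n | n <- enum 'I_d]).

(** When phi maps n to the up-set of n in a total preorder, these are the
    classes of that preorder, from the smallest elements to the largest. *)
Definition blocks_of : seq {set 'I_d} := [seq [set n | phi n == K] | K <- chain].

Definition blk (t : seq {set 'I_d}) (i : 'I_d) : nat :=
  find (fun B : {set 'I_d} => i \in B) t.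

(** When the classes of the preorder are laid out one after the other, the class
    of n is preceded by the complement of its up-set; so these are the positions
    at which a class begins. *)
Definition starts : {set 'I_d} := [set p : 'I_d | [exists n, val p == d - #|phi n|]].

Lemma phi_refl n : n \in phi n.
Proof. by rewrite phiE. Qed.

Lemma mem_chain K : reflect (exists n, K = phi n) (K \in chain).
Proof.
rewrite mem_sort mem_undup; apply: (iffP mapP) => [[n _ ->]|[n ->]]; exists n => //.
by rewrite mem_enum.
Qed.

Lemma phi_chain_mem n : phi n \in chain.
Proof. by apply/mem_chain; exists n. Qed.

Lemma chain_uniq : uniq chain.
Proof. by rewrite sort_uniq undup_uniq. Qed.

(** Up-sets of a total preorder form a chain, so sorting them by size sorts
    them by inclusion. *)
Lemma chain_cmp A B : A \in chain -> B \in chain -> (#|B| <= #|A|) = (B \subset A).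
Proof.
move=> /mem_chain[i ->] /mem_chain[j ->]; apply/idP/idP; last exact: subset_leq_card.
have := phi_total j i; rewrite !phiE => /orP[//|sub le].
by have /eqP -> : phi i == phi j by rewrite eqEcard sub.
Qed.

Lemma chain_sorted : sorted (fun A B : {set 'I_d} => B \subset A) chain.
Proof.
have : sorted (fun A B : {set 'I_d} => #|B| <= #|A|) chain.
  by apply: sort_sorted => A B; exact: leq_total.
suff <- : sorted (fun A B : {set 'I_d} => #|B| <= #|A|) chain =
          sorted (fun A B : {set 'I_d} => B \subset A) chain by [].
by apply: (eq_in_sorted (P := mem chain)); [exact: chain_cmp | exact/allP].
Qed.

Lemma index_phi i n : (index (phi n) chain <= index (phi i) chain) = (i \in phi n).
Proof.
have sub a b : index (phi a) chain <= index (phi b) chain -> phi b \subset phi a.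
  move=> le; apply: (sorted_leq_index (leT := fun A B : {set 'I_d} => B \subset A)) le.
  - by move=> A B C BA CB; exact: fintype.subset_trans CB BA.
  - by [].
  - exact: chain_sorted.
  - exact: phi_chain_mem.
  - exact: phi_chain_mem.
rewrite phiE; apply/idP/idP; first exact: sub.
move=> iN; rewrite leqNgt; apply/negP => /[dup] /ltnW/sub ni lt.
have /eqP e : phi i == phi n by rewrite finset.eqEsubset iN.
by rewrite e ltnn in lt.
Qed.

Lemma blk_blocks_of i : blk blocks_of i = index (phi i) chain.
Proof.
by rewrite /blk find_map; apply: eq_find => K /=; rewrite inE eq_sym.
Qed.

Lemma mem_phi_blk i n : (i \in phi n) = (blk blocks_of n <= blk blocks_of i).
Proof. by rewrite !blk_blocks_of index_phi. Qed.

Lemma chain_nth_mem k n : k < size chain ->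
  (n \in nth finset.set0 chain k) = (k <= index (phi n) chain).
Proof.
move=> ks; have /mem_chain[m mE] := mem_nth finset.set0 ks.
by rewrite mE -index_phi -mE index_uniq // chain_uniq.
Qed.

(** The default value, the empty set, is the up-set that would come after the
    last one; this spares a special treatment of the last block. *)
Lemma chain_nth k n :
  (n \in nth finset.set0 chain k) = (k <= index (phi n) chain).
Proof.
case: (ltnP k (size chain)) => ks; first exact: chain_nth_mem.
rewrite nth_default // inE; apply/esym/negbTE; rewrite -ltnNge.
by apply: leq_trans ks; rewrite index_mem phi_chain_mem.
Qed.

Lemma chain_layer k : k < size chain ->
  nth finset.set0 chain k :\: nth finset.set0 chain k.+1 =
  [set n | phi n == nth finset.set0 chain k].
Proof.
move=> ks; apply/setP => n; rewrite !inE !chain_nth -leqNgt.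
rewrite andbC -eqn_leq; apply/eqP/eqP => [->|->].
  by rewrite nth_index // phi_chain_mem.
by rewrite index_uniq // chain_uniq.
Qed.

Lemma chain_telescope k :
  \sum_(l < k) #|nth finset.set0 chain l :\: nth finset.set0 chain l.+1| =
  d - #|nth finset.set0 chain k|.
Proof.
suff : \sum_(l < k) #|nth finset.set0 chain l :\: nth finset.set0 chain l.+1| +
  #|nth finset.set0 chain k| = d by lia.
elim: k => [|k IH].
  rewrite big_ord0 -[RHS]card_ord -cardsT; apply: eq_card => n.
  by rewrite chain_nth inE.
rewrite big_ord_recr /= -[RHS]IH -addnA; congr addn.
rewrite cardsD (finset.setIidPr _) ?subnK //.
  apply: subset_leq_card; apply/fintype.subsetP => n; rewrite !chain_nth; lia.
apply/fintype.subsetP => n; rewrite !chain_nth; lia.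
Qed.

Lemma card_starts : #|starts| = size chain.
Proof.
have -> : size chain = size [seq d - #|K| | K : {set 'I_d} <- chain].
  by rewrite size_map.
rewrite cardE -(size_map val); apply/perm_size/uniq_perm.
- by rewrite (map_inj_uniq val_inj) enum_uniq.
- rewrite map_inj_in_uniq ?chain_uniq // => A B Ac Bc e.
  have cA : #|A| = #|B|.
    have le (X : {set 'I_d}) : #|X| <= d by rewrite -[leqRHS]card_ord max_card.
    by have := le A; have := le B; move: e => /=; lia.
  by apply/eqP; rewrite finset.eqEsubset -!chain_cmp // cA leqnn.
move=> p; apply/mapP/mapP => [[q]|[K /mem_chain[n ->] ->]].
  rewrite mem_enum inE => /existsP[n /eqP nE] ->.
  by exists (phi n); rewrite ?phi_chain_mem.
have lt : d - #|phi n| < d.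
  have : 0 < #|phi n| by apply/card_gt0P; exists n; exact: phi_refl.
  have := ltn_ord n; lia.
by exists (Ordinal lt); rewrite ?mem_enum ?inE //; apply/existsP; exists n.
Qed.

Lemma mem_phi_card i n : (i \in phi n) = (#|phi i| <= #|phi n|)%N.
Proof. by rewrite phiE chain_cmp // phi_chain_mem. Qed.

Lemma start0 (i : 'I_d) : val i = 0%N -> i \in starts.
Proof.
move=> i0; rewrite inE i0.
have /mem_chain[m mE] : nth finset.set0 chain 0 \in chain.
  by apply: mem_nth; have := phi_chain_mem i; case: chain.
apply/existsP; exists m; rewrite -mE.
have -> : nth finset.set0 chain 0 = [set: 'I_d].
  by apply/setP => n; rewrite chain_nth inE.
by rewrite cardsT card_ord subnn.
Qed.

End Chain.

Definition blk_upset (d : nat) (t : seq {set 'I_d}) (n : 'I_d) : {set 'I_d} :=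
  [set i | blk t n <= blk t i].

Lemma mem_blk_upset d (t : seq {set 'I_d}) i n :
  (i \in blk_upset t n) = (blk_upset t i \subset blk_upset t n).
Proof.
rewrite inE; apply/idP/fintype.subsetP => [le j|]; last by move/(_ i); rewrite !inE; apply.
by rewrite !inE; exact: leq_trans.
Qed.

Lemma blk_upset_total d (t : seq {set 'I_d}) i n :
  (i \in blk_upset t n) || (n \in blk_upset t i).
Proof. by rewrite !inE leq_total. Qed.

Lemma eq_blocks_of d (phi psi : 'I_d -> {set 'I_d}) : phi =1 psi ->
  blocks_of phi = blocks_of psi.
Proof.
move=> e; rewrite /blocks_of /chain (eq_map e).
by apply: eq_map => K; apply/setP => n; rewrite !inE e.
Qed.

Lemma eq_starts d (phi psi : 'I_d -> {set 'I_d}) : phi =1 psi ->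
  starts phi = starts psi.
Proof.
by move=> e; apply/setP => p; rewrite !inE; apply: eq_existsb => n; rewrite e.
Qed.

(** In a total preorder, comparing elements is comparing the sizes of their
    up-sets. *)
Lemma eq_phi_card d (phi psi : 'I_d -> {set 'I_d}) :
  (forall i n, (i \in phi n) = (phi i \subset phi n)) ->
  (forall i n, (i \in phi n) || (n \in phi i)) ->
  (forall i n, (i \in psi n) = (psi i \subset psi n)) ->
  (forall i n, (i \in psi n) || (n \in psi i)) ->
  (forall n, #|phi n| = #|psi n|) -> phi =1 psi.
Proof.
move=> phiE phiT psiE psiT e n; apply/setP => i.
by rewrite (mem_phi_card phiE phiT) (mem_phi_card psiE psiT) !e.
Qed.

Local Open Scope classical_set_scope.
Local Open Scope ring_scope.

(** * Homogeneous coordinates *)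

Section ProjCoords.
Import Defs.
Variables (R : realType) (d : nat).
Implicit Types (S : {set 'I_d}) (w : pprod R d).

Lemma hcoord_neq0 S (v : pspace R S) : exists2 i, i \in S & hcoord v i != 0.
Proof.
have /set_mem[j vj] := valP (generic_quotient.repr v).
exists (val j); first exact: valP j.
by rewrite /hcoord valK.
Qed.

Lemma coord_neq0 w S : S != finset.set0 -> exists2 i, i \in S & coord w S i != 0.
Proof.
move=> S0; rewrite /coord insubT /=.
exact: hcoord_neq0.
Qed.

(** The coordinates of a point of projective space are those of the chosen
    representative, hence known up to a common factor only. *)
Lemma hcoord_pi S (u : nzmap R S) : exists2 c : R, c != 0 &
  forall j, hcoord (\pi_(pspace R S)%qT u) (val j) = c * set_val u j.
Proof.
have : (generic_quotient.repr (\pi_(pspace R S)%qT u) = u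
  %[mod (pspace R S)])%qT by rewrite reprK.
move/esym/eqquotP => /= /asboolP[c c0 e]; exists c => // j.
by rewrite /hcoord valK e.
Qed.

Lemma pclassP S (v : 'I_d -> R) : (exists2 i, i \in S & v i != 0) ->
  exists W : pspace R S, pclass S v = Some W /\
   exists2 c : R, c != 0 & forall i, i \in S -> hcoord W i = c * v i.
Proof.
move=> [i iS vi]; rewrite /pclass.
set f := (fun i : {i : 'I_d | i \in S} => v (val i)).
have fP : f \in [set v : {ptws {i : 'I_d | i \in S} -> R} | exists i, v i != 0].
  by apply/mem_set; exists (Sub i iS); rewrite /f SubK.
rewrite insubT; pose u : nzmap R S := Sub f fP.
have uE : f = set_val u by [].
exists (\pi_(pspace R S)%qT u); split => //=.
have [c c0 ce] := hcoord_pi u; exists c => // j jS.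
have := ce (Sub j jS); rewrite SubK => ->.
by rewrite -[set_val u]uE /f SubK.
Qed.

(** The vanishing of a coordinate does not depend on the representative, so it
    can be tested before passing to the quotient. *)
Lemma closed_hcoord S i : closed [set v : pspace R S | hcoord v i = 0].
Proof.
case: (boolP (i \in S)) => iS; last first.
  rewrite (_ : mkset _ = setT); first exact: closedT.
  by apply/seteqP; split => // v _ /=; rewrite /hcoord insubN.
rewrite -[X in closed X]setCK closedC.
suff : open ((fun u : nzmap R S => \pi_(pspace R S)%qT u) @^-1`
    (~` [set v | hcoord v i = 0])) by [].
rewrite -preimage_setC; apply/closed_openC.
rewrite (_ : _ @^-1` _ =
    (set_val : nzmap R S -> {ptws {i : 'I_d | i \in S} -> R}) @^-1`
      ((fun f => f (Sub i iS)) @^-1` [set 0])).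
  apply: closed_comp; first by move=> *; exact: initial_continuous.
  apply: closed_comp; last exact: closed_eq.
  move=> f _; exact: (@proj_continuous _ (fun=> R) (Sub i iS)).
apply/seteqP; split => u /=.
  have [c c0 ce] := hcoord_pi u; have := ce (Sub i iS); rewrite SubK => -> /eqP.
  by rewrite mulf_eq0 (negbTE c0) => /eqP.
have [c c0 ce] := hcoord_pi u; have := ce (Sub i iS); rewrite SubK => -> ->.
by rewrite mulr0.
Qed.

Lemma closed_coord S i : closed [set w : pprod R d | coord w S i = 0].
Proof.
rewrite /coord; case: insubP => [S' _ _|_]; last first.
  by rewrite (_ : mkset _ = setT) ?closedT//; apply/seteqP; split.
have -> : [set w : pprod R d | hcoord (w S') i = 0] =
    (fun w : pprod R d => w S') @^-1` [set v | hcoord v i = 0] by [].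
apply: closed_comp; last exact: closed_hcoord.
by move=> w _; exact: (@proj_continuous _ (fun S0 : {S0 : {set 'I_d} | S0 != finset.set0} =>
    pspace R (val S0)) S').
Qed.

End ProjCoords.

(** * The preorder carried by a point of the B-space *)

Section PhiW.
Import Defs.
Variables (R : realType) (d : nat) (lam : 'I_d -> R).
Hypothesis lam_inj : injective lam.
Implicit Types (S : {set 'I_d}) (w : pprod R d).

Lemma Ccoef_neq0 S i : i \notin S -> Ccoef lam S i != 0.
Proof.
move=> iS; apply/prodf_neq0 => n nS; rewrite sqrf_eq0 subr_eq0.
by apply: contraNneq iS => /lam_inj <-.
Qed.

Variables (w : pprod R d) (wB : Bset lam w).

Let pair_neq0 (i n : 'I_d) : [set i; n]%SET != finset.set0.
Proof. by apply/set0Pn; exists i; rewrite !inE eqxx. Qed.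

Lemma pair_relation S i n : i \in S -> n \in S ->
  exists a b : R, [/\ a != 0, b != 0 &
    a * coord w [set i; n]%SET n * coord w S i =
    b * coord w [set i; n]%SET i * coord w S n].
Proof.
move=> iS nS.
have sub : [set i; n]%SET \subset S.
  by apply/fintype.subsetP => j; rewrite !inE => /orP[] /eqP ->.
have /= := wB.1 _ _ (pair_neq0 i n) sub i n.
rewrite !inE !eqxx orbT => /(_ isT isT) E.
exists (Ccoef lam (S :\: [set i; n])%SET i), (Ccoef lam (S :\: [set i; n])%SET n).
by split; rewrite ?E // Ccoef_neq0 // !inE eqxx ?orbT.
Qed.

(** Strict comparisons propagate from pairs to all sets: if i comes strictly
    before n on the pair, then n is invisible on every set that contains i. *)
Lemma pair_coord_eq0 S i n : i \in S -> n \in S ->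
  coord w [set i; n]%SET n = 0 -> coord w S n = 0.
Proof.
move=> iS nS w0; have [a [b [_ b0]]] := pair_relation iS nS.
have wi : coord w [set i; n]%SET i != 0.
  have [j] := coord_neq0 w (pair_neq0 i n).
  by rewrite !inE => /orP[] /eqP -> //; rewrite w0 eqxx.
rewrite w0 mulr0 mul0r => /esym/eqP.
by rewrite !mulf_eq0 (negbTE wi) (negbTE b0) => /eqP.
Qed.

(** Weak comparisons propagate as well: an element that is not strictly after i
    is visible on every set on which i is. *)
Lemma pair_coord_neq0 S i n : i \in S -> n \in S ->
  coord w [set i; n]%SET n != 0 -> coord w S i != 0 -> coord w S n != 0.
Proof.
move=> iS nS wn wi; apply/eqP => w0; have [a [b [a0 _]]] := pair_relation iS nS.
by rewrite w0 mulr0 => /eqP; rewrite !mulf_eq0 (negbTE wi) (negbTE wn) (negbTE a0).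
Qed.

(** The elements that come after n, or together with n, when n <= i is read off
    the pair {i, n} as the non-vanishing of the coordinate n. *)
Definition upset (n : 'I_d) : {set 'I_d} :=
  [set i | coord w [set i; n]%SET n != 0]%SET.

Lemma upset_refl n : n \in upset n.
Proof.
rewrite inE finset.setUid.
have n0 : [set n]%SET != finset.set0 by apply/set0Pn; exists n; rewrite inE.
by have [j /set1P ->] := coord_neq0 w n0.
Qed.

Lemma sub_upset S n : n \in S -> coord w S n != 0 -> S \subset upset n.
Proof.
move=> nS; apply: contraR => /fintype.subsetPn[i iS]; rewrite inE negbK => /eqP/pair_coord_eq0.
by move=> /(_ _ iS nS) ->.
Qed.

Lemma coord_upset n : coord w (upset n) n != 0.
Proof.
have n0 : upset n != finset.set0 by apply/set0Pn; exists n; exact: upset_refl.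
have [i iS wi] := coord_neq0 w n0.
by apply: (pair_coord_neq0 iS) => //; [exact: upset_refl | rewrite inE in iS].
Qed.

(** A set on which n is visible contains nothing strictly before n, so it lies in
    the up-set of n; and n is visible on the up-set itself.  Hence the up-set is
    the unique set of maximal size on which n is visible. *)
Lemma phi_wE n : phi_w w n = upset n.
Proof.
rewrite /phi_w; case: arg_maxnP => [|S /andP[nS wS] Smax].
  by rewrite set11; have := upset_refl n; rewrite inE finset.setUid.
apply/eqP; rewrite eqEcard sub_upset //=.
by apply: Smax; rewrite upset_refl coord_upset.
Qed.

Lemma upset_total i n : (i \in upset n) || (n \in upset i).
Proof.
rewrite !inE; have [j] := coord_neq0 w (pair_neq0 i n).
rewrite !inE => /orP[] /eqP -> wj.
  by rewrite (finset.setUC [set n]%SET) wj orbT.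
by rewrite wj.
Qed.

(** Transitivity: on the up-set of i enlarged by n some element is visible, hence
    so is i, and then n because n <= i.  So this set lies in the up-set of n. *)
Lemma upset_sub i n : i \in upset n -> upset i \subset upset n.
Proof.
move=> /[!inE] ni.
set U := (upset i :|: [set n])%SET.
have iU : i \in U by rewrite inE upset_refl.
have nU : n \in U by rewrite !inE eqxx orbT.
suff wU : coord w U n != 0.
  by apply: fintype.subset_trans (sub_upset nU wU); exact: finset.subsetUl.
have U0 : U != finset.set0 by apply/set0Pn; exists i.
have [m] := coord_neq0 w U0; rewrite !inE => /orP[im wm|/eqP -> //].
have mU : m \in U by rewrite !inE im.
apply: (pair_coord_neq0 iU nU ni).
exact: (pair_coord_neq0 mU iU im).
Qed.

Lemma upsetE i n : (i \in upset n) = (upset i \subset upset n).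
Proof.
apply/idP/idP; first exact: upset_sub.
by move=> /fintype.subsetP -> //; exact: upset_refl.
Qed.

End PhiW.

(** * Jacobi blocks and their direct sums *)

Section JacobiBlock.
Import Defs.
Variables (R : realType) (d : nat) (lam : 'I_d -> R).
Hypothesis lam_inj : injective lam.
Variables (S : {set 'I_d}) (W : pspace R S).

(** Two consecutive polynomials are treated together because the recurrence that
    defines them has two terms. *)
Lemma orth_monic_size n :
  [/\ orth lam W n \is monic, size (orth lam W n) = n.+1,
      orth lam W n.+1 \is monic & size (orth lam W n.+1) = n.+2].
Proof.
elim: n => [|n [m1 s1 m2 s2]].
  split; rewrite /= ?monic1 ?size_poly1 ?monicXsubC ?size_XsubC //.
split=> //.
- rewrite [orth _ _ _]/= -/(orth lam W n.+1) monicE lead_coefDl.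
    by rewrite -monicE rpredM ?monicXsubC.
  rewrite size_polyN (leq_ltn_trans (size_scale_leq _ _)) // s1.
  by rewrite size_Mmonic ?s2 ?size_XsubC // -size_poly_eq0 size_XsubC.
- rewrite [orth _ _ _]/= -/(orth lam W n.+1) size_polyDl.
    by rewrite size_Mmonic ?s2 ?size_XsubC // -size_poly_eq0 size_XsubC.
  rewrite size_polyN (leq_ltn_trans (size_scale_leq _ _)) // s1.
  by rewrite size_Mmonic ?s2 ?size_XsubC // -size_poly_eq0 size_XsubC.
Qed.

Hypothesis W_pos : positive W.

(** All the weights have the sign of any one of them, so that up to this sign the
    bilinear form is a positive discrete inner product with #|S| distinct nodes,
    and a polynomial of smaller degree cannot vanish at all of them. *)
Lemma ip_sign m (p : {poly R}) : m \in S -> p != 0 -> (size p <= #|S|)%N ->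
  0 < hcoord W m * ip lam W p p.
Proof.
move=> mS p0 sp; rewrite /ip mulr_sumr.
have ge0 n : n \in S -> 0 <= hcoord W m * (hcoord W n * p.[lam n] * p.[lam n]).
  move=> nS; rewrite -(mulrA (hcoord W n)) mulrA mulr_ge0 ?sqr_ge0 //.
  by rewrite ltW // W_pos.
rewrite lt_neqAle sumr_ge0 // andbT eq_sym; apply/eqP => s0.
have root n : n \in S -> root p (lam n).
  move=> nS; have /eqP := psumr_eq0P ge0 s0 nS; rewrite !mulf_eq0.
  have /lt0r_neq0 := W_pos mS nS.
  by rewrite mulf_eq0 negb_or => /andP[/negbTE -> /negbTE ->]; rewrite orbb.
have : (size (map lam (enum S)) < size p)%N.
  apply: max_poly_roots => //.
    by apply/allP => _ /mapP[n nS ->]; apply: root; rewrite mem_enum in nS.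
  by rewrite map_inj_uniq ?enum_uniq.
by rewrite size_map -cardE ltnNge sp.
Qed.

Lemma a_even_gt0 n : (0 < n < #|S|)%N -> 0 < a_even lam W n.
Proof.
case: n => // n /= nS; rewrite /a_even /offdiag_coef sqrtr_gt0 /=.
have [m1 s1 m2 s2] := orth_monic_size n.
have [m mS m0] := hcoord_neq0 W.
have := @ip_sign m (orth lam W n) mS (monic_neq0 m1).
have := @ip_sign m (orth lam W n.+1) mS (monic_neq0 m2).
rewrite s1 s2 => /(_ nS) A /(_ (ltnW nS)) B.
set x := ip _ _ _ _ in A *; set y := ip _ _ _ _ in B *.
have := mulr_gt0 A B; rewrite mulrACA -expr2 pmulr_rgt0 ?exprn_even_gt0 //=.
(* Both numbers have the sign of the weights, hence the same sign. *)
move=> xy; have y0 : y != 0 by apply: contraTneq xy => ->; rewrite mulr0 ltxx.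
have -> : x / y = (x * y) * (y^-1) ^+ 2.
  by rewrite expr2 mulrA mulfK.
by rewrite mulr_gt0 // exprn_even_gt0 //= invr_eq0.
Qed.

(** A one-element block is a 1 x 1 matrix, which contains the eigenvalue
    itself. *)
Lemma a_odd_singleton n : S = [set n]%SET -> a_odd lam W 0 = lam n.
Proof.
move=> Sn; have sum1 (F : 'I_d -> R) : \sum_(j in S) F j = F n.
  by rewrite Sn big_set1.
have nS : n \in S by rewrite Sn set11.
rewrite /a_odd /diag_coef /ip !sum1 /= !hornerE.
rewrite mulrC mulrA mulKf; first by rewrite mulr1.
by have /lt0r_neq0 := W_pos nS nS; rewrite mulf_eq0 orbb.
Qed.

Lemma jacobi_mx_sym i j : jacobi_mx lam W i j = jacobi_mx lam W j i.
Proof.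
rewrite !mxE (eq_sym j); case: eqVneq => [-> //|ij].
case: eqVneq => [e1|//]; case: eqVneq => // e2; lia.
Qed.

Lemma jacobi_mx_far (i j : 'I_#|S|) : (i.+1 < j)%N -> jacobi_mx lam W i j = 0.
Proof.
move=> ij; rewrite !mxE; case: eqVneq => [e|_]; first by rewrite e in ij; lia.
by case: eqP => [?|_]; [lia|case: eqP => // ?; lia].
Qed.

Lemma jacobi_mx_super (i j : 'I_#|S|) : i.+1 = j :> nat -> 0 < jacobi_mx lam W i j.
Proof.
move=> ij; rewrite !mxE; case: eqVneq => [e|_]; first by rewrite e in ij; lia.
by rewrite ij eqxx; apply: a_even_gt0; rewrite -ij /= ij ltn_ord.
Qed.

End JacobiBlock.

Lemma conform_mx_cast (V : nmodType) m n (e : m = n) (N : 'M[V]_m) :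
  conform_mx (0 : 'M[V]_n) N = castmx (e, e) N.
Proof. by case: _ / e; rewrite conform_mx_id castmx_id. Qed.

Section JacobiSum.
Import Defs.
Variables (R : realType) (d : nat) (lam : 'I_d -> R).
Hypothesis lam_inj : injective lam.
Variable x : psum R d.
Hypothesis x_pos : forall k : 'I_(size x), positive (tagged (tnth (in_tuple x) k)).
Local Notation p_ := (fun k : 'I_(size x) => #|tag (tnth (in_tuple x) k)|%N).
Local Notation rk := (@tagnat.Rank (size x) p_).
Hypothesis x_size : (\sum_k p_ k)%N = d.

Let M := \mxdiag_(k < size x) jacobi_mx lam (tagged (tnth (in_tuple x) k)).

Lemma jacobi_sumE i j :
  jacobi_sum lam x i j = M (cast_ord (esym x_size) i) (cast_ord (esym x_size) j).
Proof.
rewrite /jacobi_sum -/M.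
by rewrite (conform_mx_cast x_size) castmxE.
Qed.

Lemma mxdiag_block k (a b : 'I_(p_ k)) :
  M (rk k a) (rk k b) = jacobi_mx lam (tagged (tnth (in_tuple x) k)) a b.
Proof.
by rewrite -(submxblock_diag (fun k => jacobi_mx lam (tagged (tnth (in_tuple x) k))) k) !mxE.
Qed.

Lemma mxdiag_off k l (a : 'I_(p_ k)) (b : 'I_(p_ l)) : k != l ->
  M (rk k a) (rk l b) = 0.
Proof.
move=> kl; rewrite mxE; case: eqP => [|_]; last by rewrite mxE.
by move=> e; exfalso; move: e kl; rewrite !tagnat.Rank1K => ->; rewrite eqxx.
Qed.

Lemma posP (i : 'I_d) : exists k, exists a : 'I_(p_ k),
  cast_ord (esym x_size) i = rk k a /\
  i = (\sum_(l < size x | (l < k)%N) p_ l + a)%N :> nat.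
Proof.
set i' := cast_ord _ i; exists (tagnat.sig1 i'), (tagnat.sig2 i').
by rewrite tagnat.sig2K; split=> //; exact: (tagnat.rect i').
Qed.

Lemma jacobi_sum_sym i j : jacobi_sum lam x i j = jacobi_sum lam x j i.
Proof.
rewrite !jacobi_sumE; have [k [a [-> _]]] := posP i; have [l [b [-> _]]] := posP j.
case: (eqVneq k l) => [e|kl]; last by rewrite !mxdiag_off // eq_sym.
by case: _ / e in b *; rewrite !mxdiag_block jacobi_mx_sym.
Qed.

Lemma jacobi_sum_far (i j : 'I_d) : (i.+1 < j)%N -> jacobi_sum lam x i j = 0.
Proof.
move=> ij; rewrite !jacobi_sumE.
have [k [a [iE vi]]] := posP i; have [l [b [jE vj]]] := posP j.
rewrite iE jE.
case: (eqVneq k l) => [e|kl]; last by rewrite !mxdiag_off // eq_sym.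
case: _ / e in b jE vj *; rewrite !mxdiag_block jacobi_mx_far //.
by move: ij; rewrite vi vj -addnS ltn_add2l.
Qed.

Hypothesis x_ne : forall k : 'I_(size x), (0 < p_ k)%N.

(** Inside a block the superdiagonal is positive, and an index that begins a
    block is separated from its predecessor by a zero block. *)
Lemma jacobi_sum_super (i j : 'I_d) : i.+1 = j :> nat ->
  0 <= jacobi_sum lam x i j /\
  (jacobi_sum lam x i j == 0) =
    [exists k : 'I_(size x), val j == \sum_(l < size x | (l < k)%N) p_ l]%N.
Proof.
move=> ij; rewrite !jacobi_sumE.
have [k [a [iE vi]]] := posP i; have [l [b [jE vj]]] := posP j.
rewrite iE jE.
have exE : [exists k : 'I_(size x), val j == \sum_(l < size x | (l < k)%N) p_ l]%N =
   (b == 0 :> nat).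
  apply/existsP/eqP => [[k' /eqP jk']|b0]; last first.
    by exists l; rewrite /= vj b0 addn0.
  pose z : 'I_(p_ k') := Ordinal (x_ne k').
  have : nat_of_ord (rk l b) == rk k' z.
    by rewrite !tagnat.RankEsum addn0 -jk' /= vj.
  by rewrite tagnat.eq_Rank => /andP[_ /eqP].
rewrite exE.
case: (eqVneq k l) => [e|kl].
  case: _ / e in b jE vj exE *; rewrite !mxdiag_block.
  have ab : a.+1 = b :> nat.
    have := vj; rewrite -ij vi -addnS => /eqP.
    by rewrite eqn_add2l => /eqP.
  have pos := jacobi_mx_super lam_inj (@x_pos k) ab.
  by rewrite ltW // gt_eqF // -ab.
rewrite !mxdiag_off // lexx eqxx; split=> //; apply/esym.
(* The predecessor of an offset b > 0 in block l would be i, which lies in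
   block k <> l. *)
case: (posnP b) => [b0|b0]; first by apply/eqP.
have lt : (b.-1 < p_ l)%N by apply: leq_ltn_trans (leq_pred _) (ltn_ord b).
pose z : 'I_(p_ l) := Ordinal lt.
have : nat_of_ord (rk k a) == rk l z.
  by rewrite !tagnat.RankEsum /= -vi -eqSS ij vj -addnS prednK.
by rewrite tagnat.eq_Rank (negbTE kl).
Qed.

Lemma jacobi_sum_diag (i : 'I_d) (k : 'I_(size x)) n :
  val i = (\sum_(l < size x | (l < k)%N) p_ l)%N -> p_ k = 1%N ->
  n \in tag (tnth (in_tuple x) k) -> jacobi_sum lam x i i = lam n.
Proof.
move=> iE pk nk; rewrite jacobi_sumE.
have -> : cast_ord (esym x_size) i = rk k (Ordinal (x_ne k)).
  by apply: val_inj; rewrite [RHS](tagnat.RankEsum (p_ := p_)) /= addn0.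
rewrite mxdiag_block mxE eqxx /=; apply: a_odd_singleton; first exact: x_pos.
have /cards1P[m mE] : #|tag (tnth (in_tuple x) k)| == 1%N by rewrite pk.
by move: nk; rewrite mE => /set1P ->.
Qed.

End JacobiSum.

(** * The Jacobi matrix of a point of the B-space *)

Lemma map_pmap_some (A : eqType) (T U : Type) (g : A -> option T) (f : T -> U)
    (F : A -> U) (P : T -> Prop) (s : seq A) :
  (forall a, a \in s -> exists y, [/\ g a = Some y, f y = F a & P y]) ->
  map f (pmap g s) = map F s /\
  forall k : 'I_(size (pmap g s)), P (tnth (in_tuple (pmap g s)) k).
Proof.
move=> H; suff [-> HP] : map f (pmap g s) = map F s /\
    forall x0 k, (k < size (pmap g s))%N -> P (nth x0 (pmap g s) k).
  by split=> // k; rewrite (tnth_nth (tnth (in_tuple (pmap g s)) k)); apply: HP.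
elim: s H => [|a s IH] H; first by split.
have [y [ga fy Py]] := H a (mem_head _ _).
have [|IH1 IH2] := IH; first by move=> b bs; apply: H; rewrite inE bs orbT.
rewrite /= ga /=; split; first by rewrite fy IH1.
by move=> x0 [//|k] /=; exact: IH2.
Qed.

Section PiMap.
Import Defs.
Variables (R : realType) (d : nat) (lam : 'I_d -> R).
Hypothesis lam_inj : injective lam.
Variable w : Bspace lam.
Let wv := set_val w.
Let wB : Bset lam wv. Proof. exact: set_mem (valP w). Qed.
Local Notation phi := (phi_w wv).
Local Notation J := (jacobi_sum lam (pi_map w)).

Lemma phi_wP i n : (i \in phi n) = (phi i \subset phi n).
Proof. by rewrite !(phi_wE lam_inj wB) (upsetE lam_inj wB). Qed.

Lemma phi_w_total i n : (i \in phi n) || (n \in phi i).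
Proof. by rewrite !(phi_wE lam_inj wB) (upset_total wv). Qed.

(** The difference of consecutive sets of the chain is a class of the preorder;
    on it the coordinates are nonzero and, by the inequalities that define the
    B-space, of constant sign. *)
Lemma pi_map_blocks : stratum (blocks_of phi) (pi_map w).
Proof.
rewrite /stratum /= /pi_map -/wv.
have -> : phi_chain wv = chain phi by [].
set K := chain phi; set z := zip _ _.
have szz : size (rcons (behead K) finset.set0) = (size K).-1.+1.
  by rewrite size_rcons size_behead.
have zE : z = [seq (nth finset.set0 K k, nth finset.set0 K k.+1) | k <- iota 0 (size K)].
  apply: (@eq_from_nth _ (finset.set0, finset.set0)).
    by rewrite size_zip size_map size_iota szz; lia.
  move=> k; rewrite size_zip szz => ks.
  have kK : (k < size K)%N by lia.
  rewrite (nth_map 0) ?size_iota // nth_iota // add0n.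
  rewrite nth_zip_cond size_zip szz ks /=; congr pair.
  rewrite nth_rcons size_behead nth_behead; case: (ltnP k (size K).-1) => // h.
  rewrite if_same nth_default //.
  lia.
have -> : blocks_of phi = map (fun AB => [set n | phi n == AB.1]%SET) z.
  rewrite /blocks_of zE -map_comp -/K -[in LHS](mkseq_nth finset.set0 K) -map_comp.
  by [].
apply: (map_pmap_some (P := fun y : {S : {set 'I_d} & pspace R S} => positive (tagged y))).
move=> AB; rewrite zE => /mapP[k]; rewrite mem_iota add0n => /= kK ->.
rewrite /=.
have layer := chain_layer phi_wP phi_w_total kK; rewrite -/K in layer.
have [m mE] := mem_chain _ _ (mem_nth finset.set0 kK).
have coordK n : phi n = nth finset.set0 K k -> coord wv (nth finset.set0 K k) n != 0.
  by move=> <-; rewrite (phi_wE lam_inj wB) (coord_upset lam_inj wB).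
have [|W [-> [c c0 cE]]] := @pclassP R d (nth finset.set0 K k :\: nth finset.set0 K k.+1)%SET
    (coord wv (nth finset.set0 K k)).
  by exists m; [rewrite layer inE mE | apply: coordK; rewrite mE].
exists (Tagged (@pspace R d) W); split=> //= a b aS bS.
rewrite !cE // mulrACA mulr_gt0 //; first by rewrite -expr2 exprn_even_gt0.
have aK : phi a = nth finset.set0 K k by move: aS; rewrite layer inE => /eqP.
have bK : phi b = nth finset.set0 K k by move: bS; rewrite layer inE => /eqP.
rewrite lt_neqAle eq_sym mulf_neq0 ?coordK //=.
apply: wB.2; last 2 first.
- by rewrite -aK phi_wP.
- by rewrite -bK phi_wP.
by apply/set0Pn; exists a; rewrite -aK phi_wP.
Qed.

Let pos := pi_map_blocks.2.

Lemma size_pi_map : size (pi_map w) = size (chain phi).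
Proof. by rewrite -(size_map tag) pi_map_blocks.1 size_map. Qed.

Lemma tag_pi_map (k : 'I_(size (pi_map w))) :
  tag (tnth (in_tuple (pi_map w)) k) =
  (nth finset.set0 (chain phi) k :\: nth finset.set0 (chain phi) k.+1)%SET.
Proof.
have kK : (k < size (chain phi))%N by rewrite -size_pi_map.
rewrite (chain_layer phi_wP phi_w_total kK).
rewrite -(nth_map finset.set0 finset.set0 (fun K => [set n | phi n == K]%SET)) //.
have := pi_map_blocks.1; rewrite /blocks_of => <-.
have y0 := tnth (in_tuple (pi_map w)) k.
by rewrite (nth_map y0) // (tnth_nth y0).
Qed.

(** The blocks are differences of consecutive sets of the chain, so their sizes
    telescope. *)
Lemma pi_map_offset k : (k <= size (pi_map w))%N ->
  (\sum_(l < size (pi_map w) | (l < k)%N) #|tag (tnth (in_tuple (pi_map w)) l)|)%N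
  = (d - #|nth finset.set0 (chain phi) k|)%N.
Proof.
move=> kx; rewrite -(chain_telescope phi_wP phi_w_total).
rewrite (big_ord_widen _ (fun l => #|(nth finset.set0 (chain phi) l :\:
  nth finset.set0 (chain phi) l.+1)%SET|) kx).
by apply: eq_bigr => l _; rewrite tag_pi_map.
Qed.

Let x_size : (\sum_(k < size (pi_map w)) #|tag (tnth (in_tuple (pi_map w)) k)|)%N = d.
Proof.
apply: etrans (etrans (pi_map_offset (leqnn _)) _).
  by apply: eq_bigl => l; rewrite ltn_ord.
by rewrite size_pi_map nth_default // cards0 subn0.
Qed.

Let x_ne (k : 'I_(size (pi_map w))) : (0 < #|tag (tnth (in_tuple (pi_map w)) k)|)%N.
Proof.
have kK : (k < size (chain phi))%N by rewrite -size_pi_map.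
rewrite tag_pi_map (chain_layer phi_wP phi_w_total kK).
have [m mE] := mem_chain _ _ (mem_nth finset.set0 kK).
by apply/card_gt0P; exists m; rewrite inE mE.
Qed.

Lemma pi_jacobi_sym i j : J i j = J j i.
Proof. exact: jacobi_sum_sym x_size _ _. Qed.

Lemma pi_jacobi_far (i j : 'I_d) : (i.+1 < j)%N -> J i j = 0.
Proof. exact: jacobi_sum_far x_size _ _. Qed.

Lemma nth_chain_phi n :
  nth finset.set0 (chain phi) (index (phi n) (chain phi)) = phi n.
Proof. by rewrite nth_index // phi_chain_mem. Qed.

Lemma startsP_chain (j : nat) :
  (exists k : 'I_(size (pi_map w)),
    j = \sum_(l < size (pi_map w) | (l < k)%N) #|tag (tnth (in_tuple (pi_map w)) l)|)%N
  <-> exists n, j = (d - #|phi n|)%N.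
Proof.
split=> [[k ->]|[n ->]].
  have kK : (k < size (chain phi))%N by rewrite -size_pi_map.
  have [m mE] := mem_chain _ _ (mem_nth finset.set0 kK).
  by exists m; rewrite -mE pi_map_offset // ltnW.
have kK : (index (phi n) (chain phi) < size (pi_map w))%N.
  by rewrite size_pi_map index_mem phi_chain_mem.
exists (Ordinal kK); rewrite pi_map_offset; last exact: ltnW.
by rewrite [nat_of_ord _]/= nth_chain_phi.
Qed.

(** By this the starts of the classes can be read off the matrix, even after it
    has been conjugated by signs. *)
Lemma pi_jacobi_super (i j : 'I_d) : i.+1 = j :> nat ->
  0 <= J i j /\ (J i j == 0) = (j \in starts phi).
Proof.
move=> /(jacobi_sum_super lam_inj pos x_size x_ne)[-> ->]; split=> //.
rewrite inE; apply/existsP/existsP => -[k /eqP E].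
  have [|n nE] := (startsP_chain (val j)).1; first by exists k.
  by exists n; apply/eqP.
have [|k' k'E] := (startsP_chain (val j)).2; first by exists k.
by exists k'; apply/eqP.
Qed.

(** If every position begins a class, then all classes are singletons and the
    matrix is diagonal; position i carries the eigenvalue of the element that has
    i elements before it. *)
Lemma pi_jacobi_diag (i n : 'I_d) : starts phi = [set: 'I_d]%SET ->
  val i = (d - #|phi n|)%N -> J i i = lam n.
Proof.
move=> sT iE.
have kK : (index (phi n) (chain phi) < size (pi_map w))%N.
  by rewrite size_pi_map index_mem phi_chain_mem.
pose k := Ordinal kK.
have tagk : tag (tnth (in_tuple (pi_map w)) k) = [set m | phi m == phi n]%SET.
  rewrite tag_pi_map (chain_layer phi_wP phi_w_total); last by rewrite -size_pi_map.
  by rewrite [nat_of_ord k]/= nth_chain_phi.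
apply: (@jacobi_sum_diag _ _ _ _ pos x_size x_ne i k).
- rewrite pi_map_offset; last exact: ltnW.
  by rewrite iE [nat_of_ord _]/= nth_chain_phi.
- apply/eqP; rewrite eqn_leq x_ne andbT.
  have szd : size (pi_map w) = d.
    by rewrite size_pi_map -(card_starts phi_wP phi_w_total) sT cardsT card_ord.
  have := x_size; rewrite (bigD1 k) //=; set T := (X in (_ + X)%N = _) => e.
  have le : ((size (pi_map w)).-1 <= T)%N.
    rewrite -[X in (X.-1 <= _)%N]card_ord -(cardC1 k) -sum1_card.
    by apply: leq_sum => l _; exact: x_ne.
  have d0 := kK; rewrite szd in d0 le.
  by rewrite -(leq_add2r T) e; move: le (leq_ltn_trans (leq0n _) d0); clear; lia.
- by rewrite tagk inE.
Qed.

Lemma stratum_blocks t : stratum t (pi_map w) -> t = blocks_of phi.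
Proof. by case=> <- _; rewrite pi_map_blocks.1. Qed.

Lemma stratum_phi t i n : stratum t (pi_map w) ->
  (i \in phi n) = (blk t n <= blk t i)%N.
Proof.
by move=> /stratum_blocks ->; exact: (mem_phi_blk phi_wP phi_w_total).
Qed.

End PiMap.

Section Face.
Import Defs.
Variables (R : realType) (d : nat) (lam : 'I_d -> R).
Hypothesis lam_inj : injective lam.

(** Strict comparisons are closed conditions: i is strictly before n exactly when
    the coordinate n on the pair {i, n} vanishes.  Hence they persist in the
    closure of a stratum. *)
Lemma Bface_blk (t : seq {set 'I_d}) (w : Bspace lam) i n :
  Bface (lam := lam) t w -> (blk t i < blk t n)%N -> i \notin phi_w (set_val w) n.
Proof.
move=> wt lt.
pose C := [set v : Bspace lam | coord (set_val v) [set i; n]%SET n = 0].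
have clC : closed C.
  have -> : C = (set_val : Bspace lam -> pprod R d) @^-1`
      [set v | coord v [set i; n]%SET n = 0] by [].
  apply: closed_comp; last exact: closed_coord.
  by move=> *; exact: initial_continuous.
have inC (v : Bspace lam) : (i \notin phi_w (set_val v) n) =
    (coord (set_val v) [set i; n]%SET n == 0).
  by rewrite (phi_wE lam_inj (set_mem (valP v))) inE negbK.
rewrite inC; apply/eqP.
have : closure C w.
  apply: closure_subset wt => v vt; apply/eqP; rewrite -inC.
  by rewrite (stratum_phi lam_inj _ _ vt) -ltnNge.
by rewrite -(closure_id C).1.
Qed.

End Face.

(** * Ordered partitions and faces of the permutahedron *)

Section OrdPart.
Import Defs.
Variable d : nat.
Implicit Types (t : seq {set 'I_d}) (s : 'S_d).

Lemma mem_bigcup_seq (T : finType) (t : seq {set T}) x :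
  (x \in \bigcup_(B <- t) B)%SET = has (fun B : {set T} => x \in B) t.
Proof. by elim: t => [|B t IH]; rewrite ?big_nil ?inE // big_cons inE IH. Qed.

Lemma op_blk_lt t i : ordered_partition [set: 'I_d]%SET t -> (blk t i < size t)%N.
Proof.
by case/and3P => _ _ /eqP tT; rewrite /blk -has_find -mem_bigcup_seq tT inE.
Qed.

Lemma op_blk t i k : ordered_partition [set: 'I_d]%SET t -> (k < size t)%N ->
  (i \in nth finset.set0 t k) = (blk t i == k).
Proof.
move=> top kt; have bt := op_blk_lt i top.
have ib : i \in nth finset.set0 t (blk t i).
  by apply: (@nth_find _ finset.set0 (fun B : {set 'I_d} => i \in B)); rewrite has_find.
apply/idP/eqP => [ik|<- //].
case/and3P: top => _ /(pairwiseP finset.set0) pw _.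
have disj a b : (a < b)%N -> (b < size t)%N -> i \in nth finset.set0 t a ->
    i \in nth finset.set0 t b -> False.
  move=> ab bt' ia ib'.
  have /pred0P/(_ i) := pw a b (ltn_trans ab bt') bt' ab.
  by rewrite /= ia ib'.
by case: (ltngtP (blk t i) k) => // lt; [case: (disj _ _ lt kt) | case: (disj _ _ lt bt)].
Qed.

Lemma op_ne t k : ordered_partition [set: 'I_d]%SET t -> (k < size t)%N ->
  exists i, blk t i = k.
Proof.
move=> top kt; have /and3P[t0 _ _] := top.
have /set0Pn[i ik] : nth finset.set0 t k != finset.set0.
  by apply: contraNneq t0 => <-; exact: mem_nth.
by exists i; apply/eqP; rewrite -op_blk.
Qed.

Lemma face_partition_op (Rs : seq {set 'I_d}) s :
  ordered_partition [set: 'I_d]%SET Rs ->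
  ordered_partition [set: 'I_d]%SET (face_partition Rs s).
Proof.
case/and3P => R0 Rd /eqP Rc; apply/and3P; split.
- apply: contra R0 => /mapP[A AR A0].
  suff -> : finset.set0 = A by [].
  apply/setP => x; have : (s^-1)%g x \in (s @^-1: A)%SET = false by rewrite -A0 inE.
  by rewrite !inE permKV.
- rewrite pairwise_map; apply: sub_pairwise Rd => A B /= /pred0P AB.
  by apply/pred0P => x; rewrite /= !inE; exact: AB.
- apply/eqP/setP => x; rewrite mem_bigcup_seq inE has_map.
  have : s x \in (\bigcup_(B <- Rs) B)%SET by rewrite Rc inE.
  by rewrite mem_bigcup_seq => /hasP[A AR xA]; apply/hasP; exists A; rewrite /= ?inE.
Qed.

Lemma blk_face_partition (Rs : seq {set 'I_d}) s i :
  blk (face_partition Rs s) i = blk Rs (s i).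
Proof. by rewrite /blk find_map; apply: eq_find => A /=; rewrite inE. Qed.

(** Stated for an image, so as to serve both the vertices of the permutahedron
    and the refinement of a partition into intervals. *)
Lemma op_singletons (A : {set 'I_d}) (f : 'I_d -> 'I_d) : injective f ->
  ordered_partition (f @: A)%SET [seq [set f i]%SET | i <- enum A].
Proof.
move=> fi; apply/and3P; split.
- by apply/mapP => -[i _ /setP/(_ (f i))]; rewrite !inE eqxx.
- rewrite pairwise_map.
  have := enum_uniq A; rewrite uniq_pairwise; apply: sub_pairwise => i j /= ij.
  by apply/pred0P => x; rewrite /= !inE; apply/andP => -[/eqP -> /eqP/fi/eqP]; apply/negP.
- apply/eqP/setP => x; rewrite mem_bigcup_seq has_map; apply/hasP/imsetP.
    by case=> i; rewrite mem_enum => iA /=; rewrite inE => /eqP ->; exists i.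
  by case=> i iA ->; exists i; rewrite ?mem_enum //= set11.
Qed.

Lemma interval_singletons :
  interval_partition [seq [set i]%SET | i <- enum 'I_d].
Proof.
split.
  rewrite enumT -enum_setT.
  by have := @op_singletons [set: 'I_d]%SET id (fun x y e => e); rewrite imset_id.
exists [seq [:: [set i]%SET] | i <- enum 'I_d].
  by rewrite (flatten_map1 (fun i => [set i]%SET)).
elim: (enum 'I_d) => //= a l ->; rewrite andbT /ordered_partition.
rewrite big_seq1 eqxx /= !andbT inE eq_sym; apply/set0Pn; exists a; exact: set11.
Qed.

Lemma blk_singletons i : blk [seq [set j]%SET | j <- enum 'I_d] i = i.
Proof.
rewrite /blk find_map (eq_find (a2 := pred1 i)); first exact: index_enum_ord.
by move=> j /=; rewrite inE eq_sym.
Qed.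

(** Listing the blocks one after the other enumerates the whole index set; s sends
    an element to its position in that list, so that the blocks become
    consecutive intervals. *)
Lemma face_partition_surj t : ordered_partition [set: 'I_d]%SET t ->
  exists Rs s, interval_partition Rs /\ face_partition Rs s = t.
Proof.
move=> top; have /and3P[t0 td /eqP tc] := top.
pose L := flatten [seq enum B | B : {set 'I_d} <- t].
have memL i : i \in L.
  have : i \in (\bigcup_(B <- t) B)%SET by rewrite tc inE.
  rewrite mem_bigcup_seq => /hasP[B Bt iB]; apply/flattenP.
  by exists (enum B); [exact: map_f | rewrite mem_enum].
have uL : uniq L.
  rewrite /L; elim: t {top t0 tc memL L} td => //= B t IH /andP[Bd td].
  rewrite cat_uniq enum_uniq IH // andbT; apply/hasPn => x /flattenP[_ /mapP[C Ct ->]].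
  rewrite !mem_enum => xC; apply/negP => xB.
  by have /pred0P/(_ x) := allP Bd _ Ct; rewrite /= xB xC.
have szL : size L = d.
  by have /card_uniqP := uL; rewrite (eq_card (B := 'I_d)) ?card_ord // => i; rewrite memL.
have ltL i : (index i L < d)%N by rewrite -[X in (_ < X)%N]szL index_mem.
pose f i := Ordinal (ltL i).
have fi : injective f.
  move=> i j /(congr1 val) /= e.
  by rewrite -(nth_index i (memL i)) e nth_index.
pose s := perm fi.
have sE i : s i = f i by rewrite permE.
exists [seq (s @: B)%SET | B : {set 'I_d} <- t], s; split; last first.
  rewrite /face_partition -map_comp -[RHS]map_id; apply: eq_map => B /=.
  by apply/setP => x; rewrite inE mem_imset //; exact: perm_inj.
split.
  apply/and3P; split.
  - by apply: contra t0 => /mapP[B Bt /esym/eqP]; rewrite imset_eq0 => /eqP <-.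
  - rewrite pairwise_map; apply: sub_pairwise td => A B /= AB.
    by rewrite imset_disjoint //; exact: perm_inj.
  - apply/eqP/setP => x; rewrite mem_bigcup_seq inE has_map.
    have : (s^-1)%g x \in (\bigcup_(B <- t) B)%SET by rewrite tc inE.
    rewrite mem_bigcup_seq => /hasP[A AR xA]; apply/hasP; exists A => //=.
    by apply/imsetP; exists ((s^-1)%g x); rewrite ?permKV.
exists [seq [seq [set s i]%SET | i <- enum B] | B : {set 'I_d} <- t]; last first.
  by elim: (t) => //= B t' ->; rewrite andbT; apply: op_singletons; exact: perm_inj.
have -> : [seq [seq [set s i]%SET | i <- enum B] | B : {set 'I_d} <- t] =
  map (map (fun i => [set s i]%SET)) [seq enum B | B : {set 'I_d} <- t].
  by rewrite -map_comp.
rewrite -map_flatten -/L (map_comp (fun i => [set i]%SET) s); congr map.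
apply: (inj_map val_inj); apply: etrans (val_enum_ord d) _; rewrite -map_comp.
apply: (@eq_from_nth _ 0%N); first by rewrite size_iota size_map szL.
rewrite size_iota => k kd; rewrite nth_iota // add0n.
rewrite (nth_map (Ordinal kd)) ?szL //= sE /= index_uniq ?szL //.
Qed.

Lemma one_in_prod (Rs : seq {set 'I_d}) : (1 \in \prod_(A <- Rs) Sym A)%g.
Proof.
elim: Rs => [|A Rs IH]; first by rewrite big_nil inE.
by rewrite big_cons -(mulg1 1%g) mem_mulg // inE; exact: perm_on1.
Qed.

Lemma mem_face_coset Rs s : s \in face_coset Rs s.
Proof. by rewrite /face_coset mem_lcoset mulVg one_in_prod. Qed.

(** These elements of a coset are enough for what follows: they span the
    directions of the face, and exchange two elements of the same block. *)
Lemma tperm_face_coset Rs s a b : ordered_partition [set: 'I_d]%SET Rs ->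
  blk Rs a = blk Rs b -> (s * tperm a b)%g \in face_coset Rs s.
Proof.
move=> Rop ab; rewrite /face_coset mem_lcoset mulKg.
have bR := op_blk_lt a Rop.
have aA := op_blk a Rop bR; rewrite eqxx in aA.
have bA := op_blk b Rop bR; rewrite -ab eqxx in bA.
move: (mem_nth finset.set0 bR) aA bA; move: (nth _ _ _) => A.
elim: Rs {Rop ab bR} => // B Rs IH; rewrite inE big_cons => /orP[/eqP <-|AR] aA bA.
  rewrite -(mulg1 (tperm a b)) mem_mulg ?one_in_prod // inE.
  apply/fintype.subsetP => x; rewrite inE; case: tpermP => [-> //|-> //|]; by rewrite eqxx.
by rewrite -(mul1g (tperm a b)) mem_mulg ?IH // inE; exact: perm_on1.
Qed.

(** The factors of the group preserve every block: their own because they permute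
    it, the others because they fix them pointwise. *)
Lemma blk_face_coset Rs s g i : ordered_partition [set: 'I_d]%SET Rs ->
  g \in face_coset Rs s -> blk Rs (g i) = blk Rs (s i).
Proof.
move=> Rop; rewrite /face_coset mem_lcoset.
have -> : g i = (s^-1 * g)%g (s i) by rewrite permM permK.
move: (s^-1 * g)%g (s i) => {s i} {}g i.
have Rd : {in Rs &, forall A B : {set 'I_d}, A != B -> forall x, x \in A -> x \in B = false}.
  move=> A B AR BR AB x xA; apply/negP => xB.
  have := op_blk x Rop; move: AB xA xB.
  rewrite -(nth_index finset.set0 AR) -(nth_index finset.set0 BR) => AB xA xB E.
  have := E _ (etrans (index_mem _ _) AR); have := E _ (etrans (index_mem _ _) BR).
  by rewrite xA xB => /esym/eqP -> /esym/eqP e; rewrite e eqxx in AB.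
suff H g' : g' \in (\prod_(A <- Rs) Sym A)%g -> forall A x, A \in Rs ->
    (g' x \in A) = (x \in A).
  by move=> /H gA; apply: eq_in_find => A AR; exact: gA.
(* The induction is on the factors of the product, while the blocks to be
   preserved range over all of Rs. *)
move: {2 3}Rs (allss Rs) => Rs'; elim: Rs' g' {Rop g} => [|B Rs' IH] g'.
  by move=> _; rewrite big_nil => /set1gP -> A x _; rewrite perm1.
rewrite /= => /andP[BR sub]; rewrite big_cons => /mulsgP[u v]; rewrite inE => uB vP -> A x AR.
rewrite permM (IH v sub vP A _ AR).
case: (eqVneq A B) => [-> |AB]; first exact: perm_closed.
case: (boolP (x \in B)) => xB; last by rewrite (out_perm uB xB).
rewrite (Rd B A BR AR _ _ xB) 1?eq_sym //.
by apply: (Rd B A BR AR _ (u x)); rewrite 1?eq_sym // perm_closed.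
Qed.

End OrdPart.

(** * Dimensions of the faces of the permutahedron *)

Lemma affine_dim_unique (R : realType) d (A : set 'rV[R]_d) m n :
  has_affine_dim A m -> has_affine_dim A n -> m = n.
Proof.
have le (m' n' : nat) : has_affine_dim A m' -> has_affine_dim A n' -> (m' <= n')%N.
  case=> x [U [Ax xU Umin <-]] [y [V [Ay yV Vmin <-]]].
  apply/dimvS/Umin => z Az.
  by rewrite -[z - x](subrKA y) -(opprB x y) rpredB // yV.
by move=> mA nA; apply/eqP; rewrite eqn_leq !le.
Qed.

Section Dim.
Import Defs.
Variables (R : realType) (d : nat) (Rs : seq {set 'I_d}) (s : 'S_d).
Hypothesis Rop : ordered_partition [set: 'I_d]%SET Rs.

Lemma perm_point_hull (F : {set 'S_d}) g : g \in F -> hull F (perm_point R g).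
Proof.
move=> gF; exists (fun h => (h == g)%:R); split.
- by move=> h; rewrite ler0n.
- by rewrite (bigD1 g) //= eqxx big1 ?addr0 // => h /andP[_ /negbTE ->].
- rewrite (bigD1 g) //= eqxx scale1r big1 ?addr0 // => h /andP[_ /negbTE ->].
  by rewrite scale0r.
Qed.

(** The direction of the affine hull of a face is the space of the vectors whose
    coordinates sum to zero over each block, here the kernel of psi. *)
Let M : 'M[R]_(d, size Rs) := \matrix_(i, k) (blk Rs (s i) == k)%:R.
Let psi : 'Hom('rV[R]_d, 'rV[R]_(size Rs)) := linfun (mulmxr M).

Let block_reps : exists g : 'I_(size Rs) -> 'I_d, forall k, blk Rs (s (g k)) = k.
Proof.
apply: (@fin_all_exists 'I_(size Rs) (fun=> 'I_d) (fun k i => blk Rs (s i) = k)) => k.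
have [i iE] := op_ne Rop (ltn_ord k).
by exists ((s^-1)%g i); rewrite permKV.
Qed.

Let mem_ker v : (v \in lker psi) = (v *m M == 0).
Proof. by rewrite memv_ker lfunE. Qed.

Let dim_ker : \dim (lker psi) = (d - size Rs)%N.
Proof.
have full : (limg psi = fullv)%VS.
  apply/eqP; rewrite eqEsubv subvf; apply/subvP => u _.
  have [g gE] := block_reps.
  pose N : 'M[R]_(size Rs, d) := \matrix_(k, i) (i == g k)%:R.
  have NM : N *m M = 1%:M.
    apply/matrixP => k l; rewrite !mxE (bigD1 (g k)) //= !mxE eqxx mul1r gE.
    by rewrite big1 ?addr0 // => i /negbTE ik; rewrite !mxE ik mul0r.
  have -> : u = psi (u *m N) by rewrite lfunE /= -mulmxA NM mulmx1.
  by rewrite memv_img ?memvf.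
have := limg_ker_dim psi fullv.
rewrite capfv full !dimvf !dim_matrix !mul1r => e.
by rewrite -[X in (X - _)%N]e addnK.
Qed.

(** The coordinates of the vertices of a face have the same sums over each block,
    because all vertices map the block number k onto the part number k of Rs. *)
Let hull_ker y : hull (face_coset Rs s) y -> y - perm_point R s \in lker psi.
Proof.
case=> t [_ t1 ->]; rewrite mem_ker mulmxBl subr_eq0.
have constM g : g \in face_coset Rs s ->
    perm_point R g *m M = \row_k \sum_(j | blk Rs j == k) (j.+1)%:R.
  move=> gF; apply/rowP => k; rewrite !mxE [RHS]big_mkcond /=.
  rewrite [RHS](reindex_inj (@perm_inj _ g)) /=; apply: eq_bigr => i _.
  rewrite !mxE (blk_face_coset i Rop gF).
  by case: ifP; rewrite ?mulr1 ?mulr0.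
rewrite mulmx_suml (eq_bigr (fun g => t g *: (perm_point R s *m M))).
  by rewrite -scaler_suml t1 scale1r.
move=> g gF; rewrite -scalemxAl; congr (_ *: _).
by rewrite !constM // mem_face_coset.
Qed.

(** The difference of two vertices exchanged by a transposition inside a block is
    a nonzero multiple of a difference of two basis vectors, and these span the
    kernel. *)
Let ker_min (V : {vspace 'rV[R]_d}) :
  (forall y, hull (face_coset Rs s) y -> y - perm_point R s \in V) ->
  (lker psi <= V)%VS.
Proof.
move=> HV; apply/subvP => v; rewrite mem_ker => /eqP vM.
have edge i j : blk Rs (s i) = blk Rs (s j) -> delta_mx 0 i - delta_mx 0 j \in V.
  move=> ij; case: (eqVneq i j) => [->|ne]; first by rewrite subrr mem0v.
  have := HV _ (perm_point_hull (tperm_face_coset s Rop ij)).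
  have -> : perm_point R (s * tperm (s i) (s j))%g - perm_point R s =
     ((s j).+1%:R - (s i).+1%:R) *: (delta_mx 0 i - delta_mx 0 j).
    apply/rowP => k; rewrite !mxE permM eqxx /=.
    case: tpermP => [/perm_inj ->|/perm_inj ->|/eqP ki /eqP kj].
    - by rewrite eqxx (negbTE ne) subr0 mulr1.
    - by rewrite eqxx eq_sym (negbTE ne) sub0r mulrN1 opprB.
    - have -> : k == i = false by apply/negbTE/eqP => e; rewrite e eqxx in ki.
      have -> : k == j = false by apply/negbTE/eqP => e; rewrite e eqxx in kj.
      by rewrite !subrr mulr0.
  rewrite rpredZeq; case/orP => [|//].
  rewrite subr_eq0 eqr_nat eqSS => /eqP/val_inj/perm_inj e.
  by rewrite e eqxx in ne.
have [c cE] := block_reps.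
pose k i := Ordinal (op_blk_lt (s i) Rop).
have -> : v = \sum_i v 0 i *: (delta_mx 0 i - delta_mx 0 (c (k i))).
  under eq_bigr do rewrite scalerBr.
  rewrite sumrB -row_sum_delta -[LHS]subr0; congr (_ - _); apply/esym.
  rewrite (partition_big k predT) //= big1 // => l _.
  under eq_bigr => i /eqP -> do [].
  rewrite -scaler_suml; have /rowP/(_ l) := vM; rewrite !mxE => vl.
  suff -> : \sum_(i | k i == l) v 0 i = 0 by rewrite scale0r.
  rewrite -[RHS]vl big_mkcond; apply: eq_bigr => i _; rewrite !mxE.
  by rewrite -val_eqE /=; case: ifP; rewrite ?mulr1 ?mulr0.
by apply: memv_suml => i _; apply: memvZ; apply: edge; rewrite cE.
Qed.

Lemma face_affine_dim n :
  has_affine_dim (hull (R := R) (face_coset Rs s)) n <-> n = (d - size Rs)%N.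
Proof.
have H : has_affine_dim (hull (R := R) (face_coset Rs s)) (d - size Rs)%N.
  exists (perm_point R s), (lker psi).
  split; [|exact: hull_ker|exact: ker_min|exact: dim_ker].
  by apply: perm_point_hull; exact: mem_face_coset.
by split=> [/affine_dim_unique/(_ H) //|->].
Qed.

End Dim.

(** * When two cells coincide *)

Lemma sign_conjE (R : realDomainType) (b c : bool) (a : R) :
  (-1) ^+ b * a * (-1) ^+ c = (-1) ^+ (b (+) c) * a.
Proof. by rewrite mulrAC -signr_addb. Qed.

Lemma sign_conjK (R : realDomainType) (b : bool) (a : R) :
  (-1) ^+ b * a * (-1) ^+ b = a.
Proof. by rewrite sign_conjE addbb mul1r. Qed.

Lemma sign_conj_inj (R : realDomainType) (b c b' c' : bool) (x y : R) :
  0 <= x -> 0 <= y -> (-1) ^+ b * x * (-1) ^+ c = (-1) ^+ b' * y * (-1) ^+ c' ->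
  x = y /\ (x != 0 -> b (+) c = b' (+) c').
Proof.
move=> x0 y0; rewrite !sign_conjE => E.
have xy : x = y.
  by have := congr1 Num.norm E; rewrite !normrM !normr_sign !mul1r !ger0_norm.
split=> // xN0; move: E; rewrite -xy => /(mulIf xN0)/eqP.
by rewrite (inj_eq signr_inj) => /eqP.
Qed.

Section Faces.
Import Defs.
Variables (R : realType) (d : nat) (lam : 'I_d -> R).
Variable h : permutahedron R d -> Bspace lam.
Hypothesis lam_inj : injective lam.
Hypothesis h_homeo : homeomorphism h.
Hypothesis h_face : forall (Rs : seq {set 'I_d}) (s : 'S_d), interval_partition Rs ->
  h @` Pface Rs s = Bface (lam := lam) (face_partition Rs s).

Local Notation ph p := (phi_w (set_val (h p))).
Local Notation opT t := (ordered_partition [set: 'I_d]%SET t).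
Implicit Types (t : seq {set 'I_d}) (p : permutahedron R d) (e : signs d).

Let phP p : forall i n, (i \in ph p n) = (ph p i \subset ph p n).
Proof. exact: phi_wP. Qed.
Let phT p : forall i n, (i \in ph p n) || (n \in ph p i).
Proof. exact: phi_w_total. Qed.

(** The face of the permutahedron that corresponds to an ordered partition,
    described through h so that it depends on the partition only and not on
    the coset. *)
Definition pface t : set (permutahedron R d) := h @^-1` Bface (lam := lam) t.

Definition cell t e : set (Pbar h) := (fun x => \pi_(Pbar h)%qT x) @` (pface t `*` [set e]).

Lemma Pface_pface Rs s : interval_partition Rs ->
  Pface (R := R) Rs s = pface (face_partition Rs s).
Proof.
move=> iR; apply/seteqP; split=> p.
  by move=> pF; rewrite /pface /= -h_face //; exists p.
rewrite /pface /= -h_face // => -[q qF].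
by have [_ [g [hg _ _]]] := h_homeo => /(can_inj hg) <-.
Qed.

Definition vertex (s : 'S_d) : permutahedron R d :=
  exist _ (perm_point R s) (mem_set (perm_point_hull R (finset.in_setT s))).

Lemma vertex_pface Rs s g : interval_partition Rs -> g \in face_coset Rs s ->
  pface (face_partition Rs s) (vertex g).
Proof. by move=> iR gF; rewrite -Pface_pface //; exact: perm_point_hull. Qed.

(** A vertex lies on a face of the B-space with singleton blocks, which already
    forces all the strict comparisons of its preorder. *)
Lemma vertex_phi s i n : (i \in ph (vertex s) n) = (s n <= s i)%N.
Proof.
have lt a b : (s a < s b)%N -> a \notin ph (vertex s) b.
  move=> ab; have /Bface_blk H := vertex_pface (interval_singletons d)
     (mem_face_coset [seq [set i]%SET | i <- enum 'I_d] s).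
  by apply: H => //; rewrite !blk_face_partition !blk_singletons.
case: (ltngtP (s n) (s i)) => [ni|/lt/negbTE //|/val_inj/perm_inj ->].
  by have := phT (vertex s) i n; rewrite (negbTE (lt _ _ ni)) orbF.
by rewrite phP fintype.subxx.
Qed.

Lemma vertex_starts s : starts (ph (vertex s)) = [set: 'I_d]%SET.
Proof.
apply/eqP; rewrite eqEcard finset.subsetT cardsT card_ord (card_starts (phP _) (phT _)).
have inj : injective (ph (vertex s)).
  move=> i n e; apply/(@perm_inj _ s)/val_inj/eqP; rewrite eqn_leq.
  by rewrite -!vertex_phi !phP e fintype.subxx.
have u : uniq [seq ph (vertex s) n | n <- enum 'I_d].
  by rewrite map_inj_uniq ?enum_uniq.
by rewrite /chain size_sort (undup_id u) size_map size_enum_ord leqnn.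
Qed.

Lemma signed_JmxE p e i j :
  signed_Jmx h (p, e) i j = (-1) ^+ (e i) * Jmx h p i j * (-1) ^+ (e j).
Proof.
rewrite /signed_Jmx /diag_sign /= mul_mx_diag mxE mul_diag_mx mxE !mxE.
by [].
Qed.

Section SameMatrix.
Variables (p q : permutahedron R d) (e f : signs d).
Hypothesis same : signed_Jmx h (p, e) = signed_Jmx h (q, f).

Lemma same_diag i : Jmx h p i i = Jmx h q i i.
Proof. by have /matrixP/(_ i i) := same; rewrite !signed_JmxE !sign_conjK. Qed.

Lemma same_super (i j : 'I_d) : i.+1 = j :> nat ->
  Jmx h p i j = Jmx h q i j /\
  (Jmx h p i j != 0 -> e i (+) e j = f i (+) f j).
Proof.
move=> ij; have /matrixP/(_ i j) := same; rewrite !signed_JmxE.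
apply: sign_conj_inj.
  by have [] := pi_jacobi_super lam_inj (h p) ij.
by have [] := pi_jacobi_super lam_inj (h q) ij.
Qed.

End SameMatrix.

(** The matrix is tridiagonal and symmetric, so only superdiagonal entries see the
    signs. *)
Lemma cell_eq t e p f : pface t p -> (forall q, pface t q -> forall i j : 'I_d,
    i.+1 = j :> nat -> Jmx h q i j != 0 -> e i (+) e j = f i (+) f j) ->
  signed_Jmx h (p, e) = signed_Jmx h (p, f).
Proof.
move=> pt H; apply/matrixP => i j; rewrite !signed_JmxE.
rewrite !sign_conjE.
have [->|J0] := eqVneq (Jmx h p i j) 0; first by rewrite !mulr0.
congr (_ * _); congr ((-1) ^+ _).
case: (ltngtP i j) => [ij|ij|/val_inj ->]; last by rewrite !addbb.
- case: (ltngtP i.+1 j) => [ij'|ji|ij']; [|lia|by rewrite (H p pt i j)].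
  by move: J0; rewrite /Jmx pi_jacobi_far ?eqxx.
- case: (ltngtP j.+1 i) => [ij'|ji|ij']; [|lia|].
    by move: J0; rewrite /Jmx pi_jacobi_sym // pi_jacobi_far ?eqxx.
  by rewrite addbC (addbC (f i)) (H p pt j i) // /Jmx pi_jacobi_sym.
Qed.

Lemma pi_Pbar (x y : permutahedron R d * signs d) :
  (\pi_(Pbar h)%qT x = \pi_(Pbar h)%qT y) <-> signed_Jmx h x = signed_Jmx h y.
Proof.
split=> [/eqquotP/= /eqP //|E]; apply/eqquotP => /=; exact/eqP.
Qed.

(** Two diagonal Jacobi matrices with the same diagonal list the same eigenvalues
    in the same order, and the eigenvalues are distinct. *)
Lemma phi_of_diagonal p q : starts (ph p) = [set: 'I_d]%SET ->
  starts (ph q) = [set: 'I_d]%SET ->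
  (forall i, Jmx h p i i = Jmx h q i i) -> ph p =1 ph q.
Proof.
move=> sp sq E.
have card_eq n : #|ph p n| = #|ph q n|.
  have le (r : permutahedron R d) : (0 < #|ph r n| <= d)%N.
    apply/andP; split; last by rewrite -[leqRHS]card_ord max_card.
    by apply/card_gt0P; exists n; rewrite phP fintype.subxx.
  have lt : (d - #|ph p n| < d)%N by have := le p; have := ltn_ord n; lia.
  have : Ordinal lt \in starts (ph q) by rewrite sq inE.
  rewrite inE => /existsP[m /eqP /= mE].
  have := E (Ordinal lt).
  rewrite /Jmx (pi_jacobi_diag lam_inj (n := n) sp) // (pi_jacobi_diag lam_inj (n := m) sq) //.
  move=> /lam_inj nm; rewrite -nm in mE.
  have /andP[_ lp] := le p; have /andP[_ lq] := le q.
  by move: lp lq mE; clear; move: #|_| #|_| => a b; lia.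
exact: (eq_phi_card (phP p) (phT p) (phP q) (phT q) card_eq).
Qed.

(** A point of the second cell with the same matrix as the vertex g has the same
    preorder as g, and this point lies in the face of t'. *)
Lemma cell_vertex t t' e f g i n : cell t e = cell t' f -> pface t (vertex g) ->
  (blk t' i < blk t' n)%N -> (g i < g n)%N.
Proof.
move=> E gt lt.
have : cell t e (\pi_(Pbar h)%qT (vertex g, e)) by exists (vertex g, e).
rewrite E => -[[q f'] [/= qt ->] /pi_Pbar/esym same].
have sq : starts (ph q) = [set: 'I_d]%SET.
  apply/setP => j; rewrite [RHS]inE; case: (posnP j) => [j0|j0].
    exact: (start0 (phP q) (phT q)).
  have j1 : (j.-1 < d)%N by have := ltn_ord j; lia.
  have j1j : (Ordinal j1).+1 = j :> nat by rewrite /= prednK.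
  rewrite -(pi_jacobi_super lam_inj (h q) j1j).2.
  have [e1 _] := same_super same j1j.
  have [_ e2] := pi_jacobi_super lam_inj (h (vertex g)) j1j.
  by rewrite -[jacobi_sum _ _ _ _]e1 e2 vertex_starts inE.
have eqphi := phi_of_diagonal (vertex_starts g) sq (same_diag same).
have := Bface_blk lam_inj qt lt.
by rewrite -eqphi vertex_phi -ltnNge.
Qed.

(** A face is the closure of a stratum and is not empty, so the stratum is not
    empty either. *)
Lemma pface_generic t : opT t -> exists2 p, pface t p & stratum t (pi_map (h p)).
Proof.
move=> top; have [Rs [s [iR tE]]] := face_partition_surj top.
have : Bface (lam := lam) t !=set0.
  by exists (h (vertex s)); have := vertex_pface iR (mem_face_coset Rs s); rewrite tE.
case=> w0 clw; have [w wt] : (@pi_map _ _ lam @^-1` stratum t) !=set0.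
  by have [v [vt _]] := clw setT (filterT); exists v.
have [_ [g [_ gh _]]] := h_homeo.
exists (g w); last by rewrite gh.
by rewrite /pface /= gh; exact: subset_closure.
Qed.

Lemma generic_phi t p : stratum t (pi_map (h p)) -> ph p =1 blk_upset t.
Proof. by move=> pt n; apply/setP => i; rewrite inE (stratum_phi lam_inj _ _ pt). Qed.

(** An ordered partition is recovered from its preorder, by comparing both with
    the blocks of a generic point of its face. *)
Lemma op_blocks t : opT t -> t = blocks_of (blk_upset t).
Proof.
move=> /pface_generic[p _ pt]; rewrite -(eq_blocks_of (generic_phi pt)).
exact: stratum_blocks pt.
Qed.

(** The vertices of the face of t all put i strictly before n.  This excludes
    that n is in an earlier block of t than i, and that they share a block, since
    exchanging them would then give a vertex with the opposite order. *)
Lemma cell_blk t t' e f i n : opT t -> cell t e = cell t' f ->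
  (blk t' i < blk t' n)%N -> (blk t i < blk t n)%N.
Proof.
move=> top E lt; have [Rs [s [iR tE]]] := face_partition_surj top.
have vt g : g \in face_coset Rs s -> pface t (vertex g).
  by rewrite -tE; exact: vertex_pface.
have sin := cell_vertex E (vt _ (mem_face_coset Rs s)) lt.
case: (ltngtP (blk t i) (blk t n)) => // [ni|eq].
  have := Bface_blk lam_inj (vt _ (mem_face_coset Rs s)) ni.
  by rewrite vertex_phi -ltnNge ltnNge (ltnW sin).
have eqR : blk Rs (s i) = blk Rs (s n).
  by rewrite -!(blk_face_partition Rs s) tE.
have := cell_vertex E (vt _ (tperm_face_coset s iR.1 eqR)) lt.
by rewrite !permM tpermL tpermR ltnNge (ltnW sin).
Qed.

Lemma cell_partition t t' e f : opT t -> opT t' -> cell t e = cell t' f -> t = t'.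
Proof.
move=> top top' E; have eq_up : blk_upset t =1 blk_upset t'.
  have lt_eq i n : (blk t i < blk t n)%N = (blk t' i < blk t' n)%N.
    by apply/idP/idP => lt; [exact: cell_blk top' (esym E) lt | exact: cell_blk top E lt].
  by move=> n; apply/setP => i; rewrite /blk_upset !inE leqNgt lt_eq -leqNgt.
by rewrite (op_blocks top) (eq_blocks_of eq_up) -(op_blocks top').
Qed.

(** A union of initial blocks of t is a union of initial classes of the preorder
    of any point of the face. *)
Lemma pface_starts t p : pface t p -> starts (blk_upset t) \subset starts (ph p).
Proof.
move=> pt; apply/fintype.subsetP => j; rewrite !inE => /existsP[m /eqP mE].
(* k is a smallest element, for the preorder of p, of the block that begins at j. *)
have [k kE kmax] := @arg_maxnP _ m (fun i => blk t i == blk t m) (fun i => #|ph p i|) (eqxx _).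
apply/existsP; exists k; rewrite mE; apply/eqP; congr (d - #|pred_of_set _|)%N.
apply/setP => i; rewrite inE -(eqP kE); case: ltngtP => [ki|ik|e].
- apply/esym; have := phT p i k; rewrite (negbTE (Bface_blk lam_inj pt ki)) orbF //.
- by rewrite (negbTE (Bface_blk lam_inj pt ik)).
- apply/esym; rewrite (mem_phi_card (phP p) (phT p)); apply: kmax.
  by rewrite -e (eqP kE).
Qed.

(** At a generic point the superdiagonal vanishes nowhere else than at the starts
    of blocks; at all points of the face it vanishes there. *)
Lemma cell_signs t e f : opT t ->
  cell t e = cell t f <->
  (forall i j : 'I_d, i.+1 = j :> nat -> j \notin starts (blk_upset t) ->
     e i (+) e j = f i (+) f j).
Proof.
move=> top; split=> [E i j ij js|H].
  have [p pt gp] := pface_generic top.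
  have : cell t e (\pi_(Pbar h)%qT (p, e)) by exists (p, e).
  rewrite E => -[[q f'] [/= qt ->] /pi_Pbar/esym same].
  apply: (same_super same ij).2.
  by rewrite (pi_jacobi_super lam_inj (h p) ij).2 (eq_starts (generic_phi gp)).
suff sub e1 e2 : (forall i j : 'I_d, i.+1 = j :> nat -> j \notin starts (blk_upset t) ->
     e1 i (+) e1 j = e2 i (+) e2 j) -> cell t e1 `<=` cell t e2.
  apply/seteqP; split; apply: sub => // i j ij js; exact/esym/H.
move=> He _ [[p f'] [/= pt ->] <-]; exists (p, e2) => //.
apply/pi_Pbar/esym/(cell_eq pt) => q qt i j ij J0; apply: He => //.
apply: contra J0 => /(fintype.subsetP (pface_starts qt)).
by rewrite -(pi_jacobi_super lam_inj (h q) ij).2.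
Qed.

End Faces.

(** * Counting ordered partitions *)

Section CountOP.
Variable T : finType.
Implicit Types (A B : {set T}).

Lemma ordered_partition_cons A B (t : seq {set T}) :
  ordered_partition A (B :: t) =
  [&& B != finset.set0, B \subset A & ordered_partition (A :\: B)%SET t].
Proof.
rewrite /ordered_partition inE negb_or eq_sym big_cons /=.
set C := (\bigcup_(_ <- _) _)%SET.
have -> : all (fun C0 : {set T} => [disjoint B & C0]%B) t = [disjoint B & C]%B.
  apply/allP/pred0P => [H x|H D Dt].
    apply/negP => /andP[/= xB]; rewrite mem_bigcup_seq => /hasP[D Dt xD].
    by have /pred0P/(_ x) := H _ Dt; rewrite /= xB xD.
  apply/pred0P => x; apply/negP => /andP[/= xB xD].
  have := H x; rewrite /= xB mem_bigcup_seq => /negP; apply.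
  by apply/hasP; exists D.
case: (B != _) => //=; case: (_ \notin t) => /=; last by rewrite andbF.
case: (pairwise _ t); last by rewrite !andbF.
rewrite !andbT /=; apply/andP/andP => -[].
  move=> BC /eqP <-; split; first exact: finset.subsetUl.
  apply/eqP/setP => x; rewrite !inE; have /pred0P/(_ x) /= := BC.
  by case: (x \in B) => //= ->.
move=> BA /eqP CE; rewrite CE; split.
  by apply/pred0P => x; rewrite /= !inE; case: (x \in B).
by apply/eqP/setP => x; rewrite !inE; have /fintype.subsetP/(_ x) := BA;
   case: (x \in B) => //= ->.
Qed.

End CountOP.

Fixpoint op_number (r m : nat) : nat :=
  if r is r'.+1 then (\sum_(k < m) 'C(m, k.+1) * op_number r' (m - k.+1))%N
  else (m == 0)%N.

(** Choose the first block, of size k + 1, then an ordered partition of what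
    remains. *)
Lemma card_ordered_partitions (T : finType) r (A : {set T}) :
  #|[set t : r.-tuple {set T} | ordered_partition A t]%SET| = op_number r #|A|.
Proof.
elim: r A => [|r IH] A.
  have E (t : 0.-tuple {set T}) : ordered_partition A t = (finset.set0 == A).
    by rewrite tuple0 /ordered_partition big_nil.
  rewrite /= cards_eq0 eq_sym; case: eqVneq => [A0|/negbTE A0].
    transitivity #|{: 0.-tuple {set T}}|; last by rewrite card_tuple expn0.
    by apply: eq_card => t; rewrite inE E A0 eqxx.
  by apply: eq_card0 => t; rewrite inE E A0.
rewrite -sum1dep_card.
pose f (x : {set T} * r.-tuple {set T}) : r.+1.-tuple {set T} := [tuple of x.1 :: x.2].
pose g (t : r.+1.-tuple {set T}) := (thead t, [tuple of behead t]).
rewrite (reindex f); last first.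
  exists g => [[B t] _|t _].
    by congr pair; apply: val_inj.
  by rewrite /f /g /= -tuple_eta.
rewrite (eq_bigl (fun x : {set T} * r.-tuple {set T} =>
  ((x.1 != finset.set0) && (x.1 \subset A)) &&
  ordered_partition (A :\: x.1)%SET x.2)); last first.
  by move=> x /=; rewrite ordered_partition_cons andbA.
rewrite -(pair_big_dep (fun B : {set T} => (B != finset.set0) && (B \subset A))
   (fun B (t : r.-tuple {set T}) => ordered_partition (A :\: B)%SET t) (fun _ _ => 1%N)) /=.
under eq_bigr => B BA do rewrite sum1dep_card IH cardsDS ?(andP BA).2 //.
have ltB (B : {set T}) : (B != finset.set0) && (B \subset A) -> (#|B|.-1 < #|A|)%N.
  rewrite -card_gt0 => /andP[B0 /subset_leq_card]; lia.
rewrite [RHS](eq_bigr (fun k : 'I_#|A| =>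
  \sum_(B : {set T} | ((B != finset.set0) && (B \subset A)) && (#|B| == k.+1))
    op_number r (#|A| - #|B|)))%N.
  rewrite (exchange_big_dep (fun B : {set T} =>
    (B != finset.set0) && (B \subset A))) /=; last by move=> k B _ /andP[].
  apply: eq_bigr => B BA; rewrite (big_pred1 (Ordinal (ltB _ BA))) // => k.
  have : (0 < #|B|)%N by rewrite card_gt0; case/andP: BA.
  rewrite BA /= => B0; apply/eqP/eqP => [kE|->]; last by rewrite /= prednK.
  by apply: val_inj; rewrite /= kE.
move=> k _.
transitivity (\sum_(B : {set T} | ((B != finset.set0) && (B \subset A)) && (#|B| == k.+1))
    op_number r (#|A| - k.+1))%N; last by apply: eq_bigr => B /andP[_ /eqP kE]; rewrite kE.
rewrite sum_nat_cond_const -cards_draws; congr (_ * _)%N.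
apply: eq_card => B; rewrite !inE; case: (eqVneq B finset.set0) => [->|_] //=.
by rewrite cards0 andbF.
Qed.

Lemma op_number_gt r m : (m < r)%N -> op_number r m = 0%N.
Proof.
elim: r m => // r IH m mr /=; apply: big1 => k _.
by rewrite IH ?muln0 //; have := ltn_ord k; lia.
Qed.

Section SignedCount.
Variable K : numFieldType.

(** This is the Euler characteristic, for d > 0; the value 1 at d = 0 is the one
    for which the recurrence below has no boundary term. *)
Definition signed_count (d : nat) : K :=
  \sum_(n < d.+1) (- 2%:R) ^+ n * (op_number (d - n) d)%:R.

Lemma signed_count0 : signed_count 0 = 1.
Proof. by rewrite /signed_count big_ord1 /= mulr1. Qed.

(** Summing over the number r of blocks, with a bound on r that can be common to
    several values of d. *)
Lemma signed_count_rev d M : (d <= M)%N ->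
  signed_count d = \sum_(r < M.+1) (- 2%:R) ^+ (d - r) * (op_number r d)%:R.
Proof.
move=> dM; rewrite /signed_count (reindex_inj rev_ord_inj) /=.
rewrite (big_ord_widen_cond M.+1 predT (fun r =>
  (- 2%:R) ^+ (d.+1 - r.+1) * (op_number (d - (d.+1 - r.+1)) d)%:R)) //.
rewrite big_mkcond; apply: eq_bigr => r _ /=; case: ifP => rd.
  by rewrite subSS subKn.
by rewrite op_number_gt ?mulr0 //; lia.
Qed.

Lemma signed_countS m : signed_count m.+1 =
  \sum_(k < m.+1) 'C(m.+1, k.+1)%:R * (- 2%:R) ^+ k * signed_count (m - k).
Proof.
rewrite (signed_count_rev (leqnn _)) big_ord_recl /= mulr0 add0r.
transitivity (\sum_(r < m.+1) \sum_(k < m.+1)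
   (- 2%:R) ^+ (m - r) * 'C(m.+1, k.+1)%:R * (op_number r (m - k))%:R : K).
  apply: eq_bigr => r _; rewrite /bump /= add1n !subSS natr_sum mulr_sumr.
  by apply: eq_bigr => k _; rewrite subSS natrM mulrA.
rewrite exchange_big; apply: eq_bigr => k _.
rewrite (@signed_count_rev _ m) ?leq_subr // mulr_sumr; apply: eq_bigr => r _.
case: (ltnP (m - k) r) => lt; first by rewrite op_number_gt ?mulr0.
rewrite !mulrA; congr (_ * _); rewrite [LHS]mulrC -mulrA; congr (_ * _).
by rewrite -exprD; congr (_ ^+ _); have := ltn_ord k; lia.
Qed.

End SignedCount.

(** * Counting cells *)

Lemma card_fset_set_image (T : finType) (U : choiceType) (f : T -> U) (X : {set T}) :
  {in X &, injective f} -> #|` fset_set (f @` [set` X])| = #|X|.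
Proof.
move=> fi.
have -> : f @` [set` X] = [set` [fset f x | x in X]%fset].
  apply/seteqP; split=> [_ [x xX <-]|y /imfsetP[x /= xX ->]] /=.
    by apply/imfsetP; exists x.
  by exists x.
by rewrite set_fsetK card_in_imfset //= -cardE.
Qed.

Section CountFaces.
Import Defs.
Variables (R : realType) (d : nat) (lam : 'I_d -> R).
Variable h : permutahedron R d -> Bspace lam.
Hypothesis lam_inj : injective lam.
Hypothesis h_homeo : homeomorphism h.
Hypothesis h_face : forall (Rs : seq {set 'I_d}) (s : 'S_d), interval_partition Rs ->
  h @` Pface Rs s = Bface (lam := lam) (face_partition Rs s).
Local Notation opT t := (ordered_partition [set: 'I_d]%SET t).

(** The sign vector that starts with a plus (unless 0 is in D) and changes exactly
    at the positions in D. *)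
Definition signs_of (D : {set 'I_d}) : signs d :=
  fun i => odd #|[set k in D | (k <= i)%N]%SET|.

Lemma signs_of_diff D (i j : 'I_d) : i.+1 = j :> nat ->
  signs_of D i (+) signs_of D j = (j \in D).
Proof.
move=> ij; rewrite /signs_of.
have -> : [set k in D | (k <= j)%N]%SET =
    ([set k in D | (k <= i)%N] :|: (if j \in D then [set j] else finset.set0))%SET.
  apply/setP => k; rewrite !inE -ij leq_eqVlt ltnS andb_orr orbC; congr (_ || _).
  have -> : (k == i.+1 :> nat) = (k == j) by rewrite ij.
  case: eqVneq => [->|kj]; case: ifP => // jD;
    by rewrite ?inE ?eqxx ?andbT ?andbF // (negbTE kj).
rewrite finset.setUC; case: ifP => jD; last by rewrite finset.set0U addbb.
by rewrite cardsU1 !inE jD /= -ij ltnn /= addbN addbb.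
Qed.

Lemma size_op t : opT t -> #|starts (blk_upset t)| = size t.
Proof.
move=> top; rewrite (card_starts (@mem_blk_upset _ t) (@blk_upset_total _ t)).
by rewrite [in RHS](op_blocks lam_inj h_homeo h_face top) size_map.
Qed.

(** Indexes the cells: an ordered partition together with the set of positions
    inside blocks at which the sign changes. *)
Definition face_index (r : nat) : {set r.-tuple {set 'I_d} * {set 'I_d}} :=
  [set x : r.-tuple {set 'I_d} * {set 'I_d} |
    opT x.1 && (x.2 \subset ~: starts (blk_upset x.1))]%SET.

Lemma card_face_index r : #|face_index r| = (op_number r d * 2 ^ (d - r))%N.
Proof.
rewrite -sum1dep_card -(pair_big_dep (fun t : r.-tuple {set 'I_d} => opT t)
  (fun t (D : {set 'I_d}) => D \subset ~: starts (blk_upset t))%SET (fun _ _ => 1%N)) /=.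
rewrite (eq_bigr (fun=> 2 ^ (d - r))%N).
  rewrite sum_nat_cond_const; congr (_ * _)%N.
  have := card_ordered_partitions r [set: 'I_d]%SET; rewrite cardsT card_ord => <-.
  by apply: eq_card => t; rewrite !inE.
move=> t top; rewrite sum1dep_card.
have <- : #|(~: starts (blk_upset t))%SET| = (d - r)%N.
  rewrite cardsCs finset.setCK card_ord; congr (_ - _)%N.
  by rewrite (size_op top) size_tuple.
by rewrite -card_powerset; apply: eq_card => D; rewrite !inE.
Qed.

Definition cell_of r (x : r.-tuple {set 'I_d} * {set 'I_d}) : set (Pbar h) :=
  cell (h := h) (val x.1) (signs_of x.2).

Lemma cell_of_inj r : {in face_index r &, injective (@cell_of r)}.
Proof.
move=> [t D] [t' D']; rewrite !inE /= => /andP[top Ds] /andP[top' Ds'] E.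
have tt' : t = t'.
  by apply: val_inj; exact: (cell_partition lam_inj h_homeo h_face top top' E).
move: E; rewrite -tt' in Ds' *; rewrite /cell_of /=.
move=> /(cell_signs lam_inj h_homeo h_face _ _ top) E; congr pair; apply/setP => j.
case: (boolP (j \in starts (blk_upset t))) => js.
  have out (X : {set 'I_d}) : (X \subset ~: starts (blk_upset t))%SET -> j \in X = false.
    by move=> /fintype.subsetP/(_ j); rewrite finset.in_setC js;
       case: (j \in X) => // /(_ isT).
  by rewrite !out.
have j0 : (0 < j)%N.
  rewrite lt0n; apply: contraNneq js => j0.
  exact: (start0 (@mem_blk_upset _ t) (@blk_upset_total _ t)).
have j1 : (j.-1 < d)%N by have := ltn_ord j; lia.
have ij : (Ordinal j1).+1 = j :> nat by rewrite /= prednK.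
by rewrite -!(signs_of_diff _ ij); exact: E ij js.
Qed.

Lemma Pbar_facesE n : (n <= d)%N ->
  Pbar_faces (h := h) n = (@cell_of (d - n)%N) @` [set` face_index (d - n)].
Proof.
move=> nd; apply/seteqP; split=> [A|A [[t D] tD <-]].
  case=> Rs [s [e [iR dimn ->]]].
  have top := face_partition_op s iR.1.
  set t := face_partition Rs s in top.
  have szt : size t == (d - n)%N.
    have le : (size t <= d)%N by rewrite -size_op // -[leqRHS]card_ord max_card.
    have := (face_affine_dim R s iR.1 n).1 dimn.
    by rewrite /t size_map in le *; lia.
  pose D := [set j in ~: starts (blk_upset t) |
    [exists i : 'I_d, (i.+1 == j :> nat) && (e i (+) e j)]]%SET.
  exists (Tuple szt, D).
    rewrite /= inE top /=; apply/fintype.subsetP => j; rewrite inE => /andP[//].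
  rewrite /cell_of /= (_ : _ @` _ = cell (h := h) t e); last first.
    by rewrite /cell (Pface_pface h_homeo h_face s iR).
  apply/(cell_signs lam_inj h_homeo h_face _ _ top) => i j ij js.
  rewrite (signs_of_diff _ ij) inE finset.in_setC js /=.
  apply/existsP/idP => [[i' /andP[/eqP i'j]]|eij].
    by rewrite (_ : i' = i) //; apply: val_inj; apply: succn_inj; rewrite /= i'j ij.
  by exists i; rewrite ij eqxx.
move: tD; rewrite /= inE /= => /andP[top Ds].
have [Rs [s [iR tE]]] := face_partition_surj top.
exists Rs, s, (signs_of D); split=> //.
  apply/(face_affine_dim R s iR.1).
  by have := congr1 size tE; rewrite size_map size_tuple => ->; lia.
by rewrite /cell_of /cell /= -tE -(Pface_pface h_homeo h_face s iR).
Qed.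

Lemma euler_char_count : euler_char h =
  \sum_(n < d.+1) (- 2%:R) ^+ n * (op_number (d - n) d)%:R.
Proof.
apply: eq_bigr => n _; have nd : (n <= d)%N by rewrite -ltnS ltn_ord.
rewrite Pbar_facesE // card_fset_set_image; last exact: cell_of_inj.
rewrite card_face_index subKn // mulnC PoszM mulrA; congr (_ * _); last by rewrite natz.
by rewrite [RHS]exprNn; congr (_ * _); rewrite -natz natrX.
Qed.

End CountFaces.

(** * The generating function *)

Section PowerSeries.
Variable R : realType.

Definition cell_coef (d : nat) : R := signed_count R d / d`!%:R.
(** Taylor coefficients of 1 + exp (- 2 x). *)
Definition exp_sum_coef (k : nat) : R := (k == 0)%:R + (- 2%:R) ^+ k / k`!%:R.

Let fact_neq0 n : n`!%:R != 0 :> R.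
Proof. by rewrite pnatr_eq0 -lt0n fact_gt0. Qed.

Lemma cell_coefS m :
  cell_coef m.+1 = \sum_(k < m.+1) (- 2%:R) ^+ k / (k.+1)`!%:R * cell_coef (m - k).
Proof.
rewrite /cell_coef signed_countS mulr_suml; apply: eq_bigr => k _.
have km : (k <= m)%N by rewrite -ltnS.
have := bin_fact (n := m.+1) (m := k.+1) km; rewrite subSS => E.
have {}E : m.+1`!%:R = 'C(m.+1, k.+1)%:R * ((k.+1)`!%:R * (m - k)`!%:R) :> R.
  by rewrite -E !natrM.
apply: (mulIf (fact_neq0 m.+1)); rewrite mulfVK // E.
by field; rewrite !fact_neq0.
Qed.

Let norm_coef k m : `|(- 2%:R) ^+ k / m`!%:R| <= 2 ^+ k :> R.
Proof.
rewrite normrM normfV normrX normrN !ger0_norm ?ler0n //.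
by rewrite ler_piMr ?exprn_ge0 ?ler0n // invf_le1 ?ler1n ?ltr0n ?fact_gt0.
Qed.

(** Through the recurrence, a bound by 4 ^ m reproduces itself since
    2 * 4 ^ m - 2 ^ m <= 4 ^ (m + 1). *)
Lemma cell_coef_le m : `|cell_coef m| <= 4 ^+ m.
Proof.
have geo n : \sum_(k < n.+1) 2 ^+ k * 4 ^+ (n - k) = 2 * 4 ^+ n - 2 ^+ n :> R.
  elim: n => [|n IH]; first by rewrite big_ord1 !expr0; ring.
  rewrite big_ord_recr /= subnn.
  under eq_bigr => k _ do rewrite subSn -1?ltnS // exprS mulrCA.
  by rewrite -mulr_sumr IH !exprS; ring.
elim/ltn_ind: m => -[|m] IH.
  by rewrite /cell_coef signed_count0 fact0 divr1 normr1.
rewrite cell_coefS (le_trans (ler_norm_sum _ _ _)) //.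
apply: (@le_trans _ _ (\sum_(k < m.+1) 2 ^+ k * 4 ^+ (m - k))).
  apply: ler_sum => k _; rewrite normrM ler_pM ?normr_ge0 ?norm_coef //.
  by apply: IH; rewrite ltnS leq_subr.
rewrite geo exprS; have p2 : 0 <= 2 ^+ m :> R by rewrite exprn_ge0.
have p4 : 0 <= 4 ^+ m :> R by rewrite exprn_ge0.
lra.
Qed.

Lemma exp_sum_coef_le k : `|exp_sum_coef k| <= 2 * 2 ^+ k.
Proof.
rewrite /exp_sum_coef (le_trans (ler_normD _ _)) // mulr_natl mulr2n.
apply: lerD; last exact: norm_coef.
apply: (@le_trans _ _ 1); last by rewrite exprn_ege1 //; lra.
by case: (k == 0)%N; rewrite ?normr1 ?normr0 ?ler01.
Qed.

(** The recurrence for the cell coefficients says that their generating series is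
    the quotient of 2 by 1 + exp (- 2 x). *)
Lemma conv_cell_exp m :
  \sum_(k < m.+1) exp_sum_coef k * cell_coef (m - k) = 2 * (m == 0)%:R.
Proof.
case: m => [|m].
  by rewrite big_ord1 /exp_sum_coef /cell_coef signed_count0 /= expr0 fact0 !divr1; ring.
rewrite big_ord_recl /= subn0 mulr0 cell_coefS /exp_sum_coef eqxx expr0 fact0 divr1.
rewrite [X in X * _](_ : _ = 2); last by rewrite /=; ring.
rewrite mulr_sumr -big_split /= big1 // => k _.
rewrite /bump /= add1n subSS add0r exprS; ring.
Qed.

Variable x : R.
Hypothesis x_small : `|x| <= 64^-1.

(** The coefficients of degree at most n of the product of the truncated series
    are those of the constant 2.  The coefficient of degree m > n is at most
    2 (m + 1) 4 ^ m, hence its term is at most 2 / 8 ^ m for |x| <= 1 / 64; and there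
    are n + 1 such terms. *)
Lemma truncated_product n :
  `|(\sum_(i < n.+1) cell_coef i * x ^+ i) * (\sum_(k < n.+1) exp_sum_coef k * x ^+ k) - 2|
  <= 2 * (4^-1) ^+ n.
Proof.
pose P : {poly R} := \poly_(i < n.+1) cell_coef i.
pose Q : {poly R} := \poly_(i < n.+1) exp_sum_coef i.
have PE : \sum_(i < n.+1) cell_coef i * x ^+ i = P.[x] by rewrite horner_poly.
have QE : \sum_(i < n.+1) exp_sum_coef i * x ^+ i = Q.[x] by rewrite horner_poly.
have leP i : `|P`_i| <= 4 ^+ i.
  by rewrite coef_poly; case: ifP => _; rewrite ?cell_coef_le // normr0 exprn_ge0.
have leQ i : `|Q`_i| <= 2 * 2 ^+ i.
  by rewrite coef_poly; case: ifP => _; rewrite ?exp_sum_coef_le // normr0 mulr_ge0 ?exprn_ge0.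
(* The product has degree at most 2 n; the bound 2 n + 2 splits evenly at n + 1. *)
have szPQ : (size (P * Q)%R <= n.+1 + n.+1)%N.
  apply: leq_trans (size_polyMleq _ _) _.
  have := size_poly n.+1 cell_coef; have := size_poly n.+1 exp_sum_coef.
  by rewrite -/P -/Q; lia.
rewrite PE QE -hornerM (horner_coef_wide _ szPQ) big_split_ord /=.
have -> : \sum_(i < n.+1) (P * Q)`_i * x ^+ i = 2.
  rewrite big_ord_recl big1 ?addr0 => [|i _]; last first.
    rewrite coefMr; apply/eqP; rewrite mulf_eq0; apply/orP; left; apply/eqP.
    rewrite -[RHS](_ : 2 * (lift ord0 i == 0 :> nat)%:R = 0); last by rewrite mulr0.
    rewrite -conv_cell_exp; apply: eq_bigr => k _; rewrite !coef_poly.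
    have il : (lift ord0 i < n.+1)%N := ltn_ord _.
    have kl : (k <= lift ord0 i)%N by rewrite -ltnS ltn_ord.
    by rewrite (leq_ltn_trans (leq_subr _ _) il) (leq_ltn_trans kl il) mulrC.
  rewrite coefMr big_ord1 !coef_poly /= /exp_sum_coef /cell_coef signed_count0.
  by rewrite eqxx fact0 !expr0 !divr1 /=; ring.
rewrite addrAC subrr add0r (le_trans (ler_norm_sum _ _ _)) //.
have term (i : 'I_n.+1) : `|(P * Q)`_(n.+1 + i) * x ^+ (n.+1 + i)| <= 2 * 8^-1 ^+ n.+1.
  set m := (n.+1 + i)%N.
  have coef_le : `|(P * Q)`_m| <= 2 * (m.+1%:R * 4 ^+ m).
    rewrite coefM (le_trans (ler_norm_sum _ _ _)) // mulrCA.
    rewrite -[m.+1 in leRHS]card_ord -sum1_card natr_sum mulr_suml.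
    apply: ler_sum => j _; rewrite normrM mul1r.
    apply: (@le_trans _ _ (4 ^+ j * (2 * 2 ^+ (m - j)))); first by rewrite ler_pM.
    rewrite mulrCA ler_pM2l // -[in leRHS](@subnKC j m) -1?ltnS // exprD.
    rewrite ler_pM2l ?exprn_gt0 //.
    by rewrite lerXn2r ?nnegrE ?ler_nat.
  have mle : m.+1%:R <= 2 ^+ m :> R by rewrite -natrX ler_nat ltn_expl.
  rewrite normrM normrX.
  apply: (@le_trans _ _ (2 * (2 ^+ m * 4 ^+ m) * 64^-1 ^+ m)).
    rewrite ler_pM ?exprn_ge0 ?normr_ge0 //; last by rewrite lerXn2r ?nnegrE.
    by rewrite (le_trans coef_le) // ler_pM2l // ler_pM2r ?exprn_gt0.
  rewrite -mulrA ler_pM2l // -!exprMn.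
  rewrite (_ : 2 * 4 * 64^-1 = 8^-1 :> R); last by field.
  by rewrite ler_wiXn2l ?leq_addr // ?invr_ge0 // invf_le1 ?ler1n.
apply: (le_trans (ler_sum _ (fun i _ => term i))).
rewrite sumr_const card_ord -[leLHS]mulr_natr -mulrA ler_pM2l //.
have nle : n.+1%:R <= 2 ^+ n.+1 :> R by rewrite -natrX ler_nat ltnW // ltn_expl.
apply: (@le_trans _ _ (8^-1 ^+ n.+1 * 2 ^+ n.+1)).
  by rewrite ler_pM2l ?exprn_gt0 ?invr_gt0.
rewrite -exprMn (_ : 8^-1 * 2 = 4^-1 :> R); last by field.
by rewrite ler_wiXn2l // ?invr_ge0 // invf_le1 ?ler1n.
Qed.

Lemma exp_sum_series :
  (fun n => \sum_(k < n.+1) exp_sum_coef k * x ^+ k) @ \oo --> 1 + expR (- 2 * x).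
Proof.
have -> : (fun n => \sum_(k < n.+1) exp_sum_coef k * x ^+ k) =
    (fun n => 1 + series (exp_coeff (- 2 * x)) n.+1).
  apply/funext => n; rewrite /exp_sum_coef; under eq_bigr do rewrite mulrDl.
  rewrite big_split /=; congr (_ + _).
    by rewrite big_ord_recl /= mulr1 big1 ?addr0 // => k _; rewrite mul0r.
  rewrite /series /= big_mkord; apply: eq_bigr => k _.
  by rewrite /exp_coeff /= exprMn mulrAC.
apply: cvgD; first exact: cvg_cst.
have c : series (exp_coeff (- 2 * x)) n @[n --> \oo] --> expR (- 2 * x).
  exact: is_cvg_series_exp_coeff.
by rewrite -cvg_shiftS in c.
Qed.

Lemma tanh_series :
  (\sum_(1 <= d < n) cell_coef d * x ^+ d) @[n --> \oo] --> tanh x.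
Proof.
pose Bn n := \sum_(i < n.+1) cell_coef i * x ^+ i.
pose Gn n := \sum_(k < n.+1) exp_sum_coef k * x ^+ k.
have G0 : 1 + expR (- 2 * x) != 0 by rewrite gt_eqF // addr_gt0 ?expR_gt0.
have BG : Bn n * Gn n @[n --> \oo] --> (2 : R).
  apply/subr_cvg0; apply: norm_cvg0.
  apply: (@squeeze_cvgr _ _ _ _ (fun=> 0) (geometric 2 4^-1)).
  - by near=> n; rewrite normr_ge0 /= truncated_product.
  - exact: cvg_cst.
  - by apply: cvg_geometric; rewrite ger0_norm ?invr_ge0 // invf_lt1 ?ltr1n.
have B : Bn n @[n --> \oo] --> 2 / (1 + expR (- 2 * x)).
  have E : {near \oo, (fun n => (Bn n * Gn n) * (Gn n)^-1) =1 Bn}.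
    have N0 : \forall n \near \oo, Gn n != 0 by exact: cvgr_neq0 exp_sum_series G0.
    by apply: filterS N0 => n Gn0; rewrite /= mulfK.
  have C : (Bn n * Gn n) * (Gn n)^-1 @[n --> \oo] --> 2 / (1 + expR (- 2 * x)).
    exact: cvgM BG (cvgV G0 exp_sum_series).
  by apply: cvg_trans C; apply: near_eq_cvg.
rewrite -cvg_shiftS.
have -> : (fun n => \sum_(1 <= d < n.+1) cell_coef d * x ^+ d) = (fun n => Bn n - 1).
  apply/funext => n; rewrite /Bn big_ord_recl /= expr0 mulr1.
  rewrite {2}/cell_coef signed_count0 fact0 divr1 addrC addKr.
  by rewrite big_add1 /= big_mkord; apply: eq_bigr => i _.
have -> : tanh x = 2 / (1 + expR (- 2 * x)) - 1.
  have -> : - 2 * x = - x - x by ring.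
  rewrite /tanh expRD !expRN; field.
  have p := expR_gt0 x; have p2 : 0 < expR x * expR x by rewrite mulr_gt0.
  rewrite !gt_eqF //; by rewrite ?addr_gt0.
by apply: cvgB => //; exact: cvg_cst.
Unshelve. all: by end_near.
Qed.

End PowerSeries.

Unset Implicit Arguments.

Theorem theorem36 (R : realType) (lam : forall d : nat, 'I_d -> R)
    (h : forall d : nat, permutahedron R d -> Bspace (lam d))
    (lam_inj : forall d : nat, (0 < d)%N -> injective (lam d))
    (h_homeo : forall d : nat, (0 < d)%N -> homeomorphism (h d))
    (h_face : forall (d : nat), (0 < d)%N ->
       forall (Rs : seq {set 'I_d}) (s : 'S_d), interval_partition Rs ->
       h d @` Pface Rs s = Bface (lam := lam d) (face_partition Rs s)) :
  \forall x \near (0 : R),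
    (\sum_(1 <= d < n) (euler_char (h d))%:~R * (x ^+ d / d`!%:R))
      @[n --> \oo] --> tanh x.
Proof.
have small : (0 : R) < 64^-1 by rewrite invr_gt0.
apply: filterS (nbhs0_le small) => x xs.
have := tanh_series xs.
rewrite (_ : (fun n => _) = fun n =>
  \sum_(1 <= d < n) (euler_char (h d))%:~R * (x ^+ d / d`!%:R)) //.
apply/funext => n; apply: eq_big_nat => d /andP[d0 _].
rewrite (euler_char_count (lam_inj d d0) (h_homeo d d0) (h_face d d0)).
rewrite /cell_coef /signed_count.
rewrite mulrAC mulrA rmorph_sum /=; congr (_ * _ / _); apply: eq_bigr => k _.
by rewrite rmorphM rmorphXn rmorphN /= !rmorph_nat.
Qed.
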